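(* For every constant $c$, $c$-Colored Token Swapping can be solved in $O(n^{c+2})$ time on graphs of maximum degree at most 2, where $n$ is the number of vertices.
   Context: Graphs are finite, simple and undirected; $n=|V|$. For $C=\{1,\dots,c\}$, a token-placement of $G=(V,E)$ is a surjective map $f\colon V\to C$. Two distinct token-placements $f,f'$ are adjacent if there is an edge $uv\in E$ with $f'(u)=f(v)$, $f'(v)=f(u)$ and $f'(w)=f(w)$ for all other $w$. A swapping sequence between $f$ and $f'$ is a sequence $f_1=f,\dots,f_h=f'$ of token-placements with consecutive members adjacent; its length is $h-1$. $\mathrm{OPT}(f,f')$ is the minimum length of such a sequence ($\infty$ if none). $c$-Colored Token Swapping is the decision problem: given $G$, token-placements $f_0,f_t\colon V\to\{1,\dots,c\}$ and an integer $\ell\ge0$, decide whether $\mathrm{OPT}(f_0,f_t)\le\ell$. *)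

(* Defs.v *)
From mathcomp Require Import all_boot all_order.
Set Implicit Arguments. Unset Strict Implicit. Unset Printing Implicit Defensive.

Definition simple_graph n (G : rel 'I_n) : Prop :=
  irreflexive G /\ symmetric G.

Definition max_degree_le n (G : rel 'I_n) (d : nat) : Prop :=
  forall v : 'I_n, #|[pred u | G v u]| <= d.

Definition placement n := {ffun 'I_n -> nat}.

Definition token_placement c n (f : placement n) : bool :=
  [forall v, (1 <= f v <= c)%N] &&
  all (fun k => [exists v, f v == k]) (iota 1 c).

Definition adjacent_placements n (G : rel 'I_n) (f f' : placement n) : bool :=
  (f != f') &&
  [exists u, exists v,
     [&& G u v, f' u == f v, f' v == f u &
      [forall w, ((w != u) && (w != v)) ==> (f' w == f w)]]].

(* A swapping sequence f_1 = f, ..., f_h = f' is  f :: s  with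
   last f s = f'; its length is h - 1 = size s.
   OPT(f,f') <= l  iff such a sequence of length <= l exists. *)
Definition OPT_le c n (G : rel 'I_n) (f f' : placement n) (l : nat) : Prop :=
  exists s : seq (placement n),
    [/\ path (adjacent_placements G) f s, last f s = f',
        all (@token_placement c n) (f :: s) & size s <= l].

(* Machine model: unit-cost RAM (registers hold naturals, indirect     *)
(* addressing, addition and truncated subtraction only, read-only      *)
(* input array).  One instruction = one time step.                     *)

Inductive instr :=
| IConst of nat & nat
| IAdd of nat & nat & nat
| ISub of nat & nat & nat
| ILoad of nat & nat
| IStore of nat & nat
| IRead of nat & nat
| IJz of nat & nat
| IHalt.

Definition program := seq instr.

Record ram_state := RamState { pc : nat; regs : nat -> nat }.

Definition upd (R : nat -> nat) (i x : nat) : nat -> nat :=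
  fun j => if j == i then x else R j.

(* The machine is halted when pc points to IHalt or outside the program. *)
Definition halted (P : program) (s : ram_state) : bool :=
  match nth IHalt P (pc s) with IHalt => true | _ => false end.

Definition step (P : program) (inp : seq nat) (s : ram_state) : ram_state :=
  let R := regs s in
  let p := pc s in
  match nth IHalt P p with
  | IConst r k => RamState p.+1 (upd R r k)
  | IAdd r a b => RamState p.+1 (upd R r (R a + R b))
  | ISub r a b => RamState p.+1 (upd R r (R a - R b))
  | ILoad r a => RamState p.+1 (upd R r (R (R a)))
  | IStore a b => RamState p.+1 (upd R (R a) (R b))
  | IRead r a => RamState p.+1 (upd R r (nth 0 inp (R a)))
  | IJz a t => RamState (if R a == 0 then t else p.+1) R
  | IHalt => s
  end.

Fixpoint exec (P : program) (inp : seq nat) (t : nat) (s : ram_state) : ram_state :=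
  match t with
  | 0 => s
  | t'.+1 => if halted P s then s else exec P inp t' (step P inp s)
  end.

Definition init_state : ram_state := RamState 0 (fun _ => 0).

Definition runs_within (P : program) (inp : seq nat) (T out : nat) : Prop :=
  let s := exec P inp T init_state in halted P s /\ regs s 0 = out.

Definition encode_instance n (G : rel 'I_n) (f0 ft : placement n) (l : nat)
  : seq nat :=
  [:: n; l] ++ [seq f0 v | v <- enum 'I_n] ++ [seq ft v | v <- enum 'I_n]
  ++ [seq nat_of_bool (G u v) | u <- enum 'I_n, v <- enum 'I_n].

(* Main.v *)
Require Import Defs.
From mathcomp Require Import all_boot all_order all_algebra fingroup perm.
From mathcomp Require Import zify.
Import Order.TTheory GRing.Theory Num.Theory.

(* Components are paths or cycles and can be treated separately.  On a cycle of
   length m, lift positions to the universal cover: a swapping sequence sends the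
   token at x to the position r x after q x turns, where the q x sum to 0.  Each
   swap changes the signed crossing number (winding) of one pair of tokens by 1,
   and as long as some winding is nonzero, swapping a suitable adjacent pair brings
   one of them closer to 0; so the optimum is the least total crossing number over
   all (q, r).  On a path the same holds with q = 0.
   Tokens of equal colour never cross.  Summing the vanishing windings over a
   colour class of size k gives k * q x + rank (r x) = flux + rank x, so that
   (q, r) is determined by one flux per colour, the sum of q over the class.  The
   fluxes sum to 0, and in an optimal solution they are at most 2m in absolute
   value.  Trying all of them costs n^(c-1) evaluations of cost n^2 for each of at
   most n components.
   The algorithm is written with loops of length k1 * n + k2 only, so that its
   running time can be read off the nesting depth of the loops. *)

(** * A loop language compiled to the machine *)

(** The optimum of a walk is squeezed between two notions. A swapping sequence yields a
    configuration that keeps equal colours in order ([order_feasible]); conversely any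
    configuration, in order or not, is realised by swaps within its cost ([feasible]), because an
    exchange of equal colours can be left out. The search only has to find a cost that is feasible
    and below every order-feasible one. The bound on the fluxes comes from a comparison: the
    configuration that makes no turns and keeps ranks costs at most m^2, counted over ordered pairs,
    and m times the absolute value of a flux exceeds the cost by at most m^2. Costs stay doubled and
    are compared with 2l. The machine has neither multiplication, nor division, nor negative
    numbers; hence fluxes and turns are shifted by 2n, absolute values are sums of two truncated
    differences, and division is a loop. *)

Inductive expr :=
| Cst of nat
| Rd of nat & expr
| Inp of expr
| Add of expr & expr
| Sub of expr & expr.

Inductive com :=
| Skip
| Asg of nat & expr & expr
| Seq of com & com
| If of expr & com & com
| Loop of nat & nat & nat & nat & com.

Definition store := nat -> nat -> nat.

Definition set_cell (s : store) (a i x : nat) : store :=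
  fun a' => if a' == a then fun i' => if i' == i then x else s a i' else s a'.

Section Semantics.
Variable inp : seq nat.

Fixpoint eval (s : store) (e : expr) : nat :=
  match e with
  | Cst k => k
  | Rd a e => s a (eval s e)
  | Inp e => nth 0 inp (eval s e)
  | Add e1 e2 => eval s e1 + eval s e2
  | Sub e1 e2 => eval s e1 - eval s e2
  end.

(* Input entry 0 is the size [n], so loop lengths are known in advance. *)
Definition bound k1 k2 := k1 * nth 0 inp 0 + k2.

Fixpoint sem (c : com) (s : store) : store :=
  match c with
  | Skip => s
  | Asg a e1 e2 => set_cell s a (eval s e1) (eval s e2)
  | Seq c1 c2 => sem c2 (sem c1 s)
  | If e c1 c2 => if eval s e != 0 then sem c1 s else sem c2 s
  | Loop k1 k2 a i b =>
      foldl (fun s t => sem b (set_cell s a i t)) s (iota 0 (bound k1 k2))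
  end.

End Semantics.

(* Register [i * stride + a] holds entry [i] of array [a].  Array 0 is a stack
   of temporaries and array 1 holds the loop counters; programs use the others. *)
Definition stride := 32.
Definition loc (a i : nat) := i * stride + a.

Fixpoint expr_wf (e : expr) : bool :=
  match e with
  | Cst _ => true
  | Rd a e => (1 < a < stride) && expr_wf e
  | Inp e => expr_wf e
  | Add e1 e2 | Sub e1 e2 => expr_wf e1 && expr_wf e2
  end.

Fixpoint com_wf (c : com) : bool :=
  match c with
  | Skip => true
  | Asg a e1 e2 => [&& 1 < a < stride, expr_wf e1 & expr_wf e2]
  | Seq c1 c2 => com_wf c1 && com_wf c2
  | If e c1 c2 => [&& expr_wf e, com_wf c1 & com_wf c2]
  | Loop _ _ a _ b => (1 < a < stride) && com_wf b
  end.

Notation tmp d := (loc 0 d).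
Notation ctr d := (loc 1 d).

(** Five doublings multiply by [stride], which is 2^5. *)
Definition to_addr a d : seq instr :=
  nseq 5 (IAdd (tmp d) (tmp d) (tmp d)) ++
  [:: IConst (tmp d.+1) a; IAdd (tmp d) (tmp d) (tmp d.+1)].

Arguments to_addr : simpl never.

Fixpoint cexp (e : expr) (d : nat) : seq instr :=
  match e with
  | Cst k => [:: IConst (tmp d) k]
  | Rd a e => cexp e d ++ to_addr a d ++ [:: ILoad (tmp d) (tmp d)]
  | Inp e => cexp e d ++ [:: IRead (tmp d) (tmp d)]
  | Add e1 e2 => cexp e1 d ++ cexp e2 d.+1 ++ [:: IAdd (tmp d) (tmp d) (tmp d.+1)]
  | Sub e1 e2 => cexp e1 d ++ cexp e2 d.+1 ++ [:: ISub (tmp d) (tmp d) (tmp d.+1)]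
  end.

Definition bound_expr k1 k2 := iter k1 (Add (Inp (Cst 0))) (Cst k2).

(** The machine only jumps on zero, so an unconditional jump first makes its own zero. *)
Definition goto t : seq instr := [:: IConst (tmp 0) 0; IJz (tmp 0) t].

Arguments goto : simpl never.

Fixpoint csize (c : com) : nat :=
  match c with
  | Skip => 0
  | Asg a e1 e2 => size (cexp e1 0) + (7 + (size (cexp e2 1) + 1))
  | Seq c1 c2 => csize c1 + csize c2
  | If e c1 c2 => size (cexp e 0) + (1 + (csize c1 + (2 + csize c2)))
  | Loop k1 k2 a i b => 1 + (size (cexp (bound_expr k1 k2) 0) + (4 + (csize b + 4)))
  end.

(* [p] is the address at which the code is placed, [d] the loop depth: the
   counter of a loop at depth [d] lives in cell [ctr d]. *)
Fixpoint ccom (c : com) (p d : nat) : seq instr :=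
  match c with
  | Skip => [::]
  | Asg a e1 e2 => cexp e1 0 ++ to_addr a 0 ++ cexp e2 1 ++ [:: IStore (tmp 0) (tmp 1)]
  | Seq c1 c2 => ccom c1 p d ++ ccom c2 (p + csize c1) d
  | If e c1 c2 =>
      let p1 := p + size (cexp e 0) + 1 in
      let p2 := p1 + csize c1 + 2 in
      cexp e 0 ++ [:: IJz (tmp 0) p2] ++ ccom c1 p1 d ++
      goto (p2 + csize c2) ++ ccom c2 p2 d
  | Loop k1 k2 a i b =>
      let be := cexp (bound_expr k1 k2) 0 in
      let p1 := p + 1 + size be + 4 in
      [:: IConst (ctr d) 0] ++ be ++
      [:: ISub (tmp 0) (tmp 0) (ctr d); IJz (tmp 0) (p1 + csize b + 4);
          IConst (tmp 1) 0; IAdd (loc a i) (ctr d) (tmp 1)] ++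
      ccom b p1 d.+1 ++
      [:: IConst (tmp 0) 1; IAdd (ctr d) (ctr d) (tmp 0)] ++ goto p.+1
  end.

(** An upper bound independent of the store: both branches of a conditional are charged, and a loop
    pays one extra round for its exit test. *)
Fixpoint cost (n : nat) (c : com) : nat :=
  match c with
  | Skip => 0
  | Asg a e1 e2 => csize (Asg a e1 e2)
  | Seq c1 c2 => cost n c1 + cost n c2
  | If e c1 c2 => size (cexp e 0) + 3 + cost n c1 + cost n c2
  | Loop k1 k2 a i b =>
     (k1 * n + k2).+1 * (size (cexp (bound_expr k1 k2) 0) + 9 + cost n b)
  end.

Lemma size_ccom c p d : size (ccom c p d) = csize c.
Proof.
elim: c p d => //=.
- move=> a e1 e2 p d; rewrite /to_addr !size_cat /= !size_cat /=; lia.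
- by move=> c1 IH1 c2 IH2 p d; rewrite size_cat IH1 IH2.
- by move=> e c1 IH1 c2 IH2 p d; rewrite !size_cat /= !size_cat IH1 /= IH2.
- by move=> k1 k2 a i b IH p d; rewrite !size_cat /= !size_cat IH.
Qed.

Definition code_at (P : program) (p : nat) (code : seq instr) :=
  forall k, k < size code -> nth IHalt P (p + k) = nth IHalt code k.

Lemma code_at_cat P p c1 c2 :
  code_at P p (c1 ++ c2) <-> code_at P p c1 /\ code_at P (p + size c1) c2.
Proof.
split=> [H | [H1 H2] k].
- split=> k hk; first by rewrite H ?size_cat ?nth_cat ?hk //; lia.
  rewrite -addnA H ?size_cat ?ltn_add2l // nth_cat ltnNge leq_addr /=.
  by rewrite addKn.
- rewrite size_cat nth_cat; case: (ltnP k (size c1)) => hk hk2; first exact: H1.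
  by rewrite -H2; [congr nth; lia | lia].
Qed.

Lemma code_at_cons P p i c :
  code_at P p (i :: c) <-> nth IHalt P p = i /\ code_at P p.+1 c.
Proof.
rewrite -cat1s code_at_cat /= addn1; split=> -[H1 H2]; split=> //.
  by have := H1 0 isT; rewrite addn0.
by case=> // _; rewrite addn0.
Qed.

(** * Simulation of the loop language by machine code *)

Section Simulation.
Variables (P : program) (inp : seq nat).

Definition reach (p : nat) R (t : nat) (p' : nat) R' :=
  iter t (step P inp) (RamState p R) = RamState p' R'.

Lemma reach_trans p R t p' R' t' p'' R'' :
  reach p R t p' R' -> reach p' R' t' p'' R'' -> reach p R (t + t') p'' R''.
Proof. by rewrite /reach addnC iterD => -> ->. Qed.

Lemma reach1 p R p' R' : step P inp (RamState p R) = RamState p' R' ->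
  reach p R 1 p' R'.
Proof. by []. Qed.

Definition is_tmp d j := exists2 d', d <= d' & j = tmp d'.

Lemma loc_inj a i a' i' : a < stride -> a' < stride ->
  loc a i = loc a' i' -> a = a' /\ i = i'.
Proof. rewrite /loc /stride; lia. Qed.

Lemma loc_neq a i a' i' : a < stride -> a' < stride ->
  (a <> a') \/ (i <> i') -> loc a i != loc a' i'.
Proof. by move=> ha ha' h; apply/eqP=> /loc_inj[//|//|]; lia. Qed.

Lemma loc_tmp d a i : 0 < a < stride -> ~ is_tmp d (loc a i).
Proof. by move=> h [d' _ /loc_inj]; case=> //; lia. Qed.

Definition agree (R : nat -> nat) (s : store) :=
  forall a i, 1 < a < stride -> R (loc a i) = s a i.

Lemma doublingP k d p R :
  code_at P p (nseq k (IAdd (tmp d) (tmp d) (tmp d))) ->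
  exists R', [/\ reach p R k (p + k) R', R' (tmp d) = 2 ^ k * R (tmp d) &
    forall j, j != tmp d -> R' j = R j].
Proof.
elim: k p R => [|k IH] p R; first by exists R; rewrite addn0 mul1n.
move=> /code_at_cons[h /(IH p.+1 (upd R (tmp d) (R (tmp d) + R (tmp d))))].
case=> R' [S V F]; exists R'; split.
- rewrite -add1n addnA addn1; apply: reach_trans S.
  by apply: reach1; rewrite /step /= h.
- by rewrite V /upd eqxx expnSr -mulnA mul2n addnn.
- by move=> j hj; rewrite F // /upd (negbTE hj).
Qed.

Lemma to_addrP a d p R : code_at P p (to_addr a d) ->
  exists R', [/\ reach p R 7 (p + 7) R', R' (tmp d) = loc a (R (tmp d)) &
    forall j, ~ is_tmp d j -> R' j = R j].
Proof.
move=> /code_at_cat[h /code_at_cons[h1 /code_at_cons[h2 _]]].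
have [R1 [S1 V1 F1]] := doublingP _ _ _ R h.
have ne : (tmp d == tmp d.+1) = false by apply/eqP; rewrite /loc /stride; lia.
eexists; split.
- apply: (reach_trans _ _ 5 _ _ 2 _ _ S1); apply: (reach_trans _ _ 1 _ _ 1).
    by apply: reach1; rewrite /step /= h1.
  by apply: reach1; rewrite /step /= h2 (addnS p 6) (addnS p 5).
- by rewrite /upd !eqxx ne V1 mulnC.
- move=> j hj; have h3 d' : d <= d' -> (j == tmp d') = false.
    by move=> hd; apply/eqP=> E; apply: hj; exists d'.
  by rewrite /upd !h3 // F1 ?h3.
Qed.

Lemma agree_frame d (R1 R2 : nat -> nat) s :
  (forall j, ~ is_tmp d j -> R2 j = R1 j) -> agree R1 s -> agree R2 s.
Proof. by move=> h hR a i ha; rewrite h ?hR //; apply: loc_tmp; lia. Qed.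

(** Evaluation at stack level [d] touches only temporaries from [d] upwards, so a left operand
    survives the evaluation of the right one at level [d.+1]. *)
Lemma cexpP s e d p R : expr_wf e -> agree R s -> code_at P p (cexp e d) ->
  exists R', [/\ reach p R (size (cexp e d)) (p + size (cexp e d)) R',
    R' (tmp d) = eval inp s e & forall j, ~ is_tmp d j -> R' j = R j].
Proof.
have up d' j : ~ is_tmp d' j -> ~ is_tmp d'.+1 j.
  by move=> h [x hx E]; apply: h; exists x => //; lia.
have neq_tmp d' j : ~ is_tmp d' j -> (j == tmp d') = false.
  by move=> h; apply/eqP => E; apply: h; exists d'.
elim: e d p R => [k|a e IH|e IH|e1 IH1 e2 IH2|e1 IH1 e2 IH2] d p R;
  rewrite /cexp -/cexp /expr_wf -/expr_wf /eval -/eval.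
- move=> _ hR /code_at_cons[h _]; eexists; split.
  + by rewrite /reach /= /step /= h /= addn1.
  + by rewrite /upd eqxx.
  + by move=> j hj; rewrite /upd neq_tmp.
- move=> /andP[ha he] hR /code_at_cat[h1 /code_at_cat[h2 /code_at_cons[h3 _]]].
  have [R1 [S1 V1 F1]] := IH _ _ _ he hR h1.
  have [R2 [S2 V2 F2]] := to_addrP _ _ _ R1 h2.
  eexists; split.
  + rewrite size_cat; apply: reach_trans S1 _; rewrite size_cat addnA.
    apply: reach_trans S2 _; apply: reach1.
    by rewrite /step /pc (h3 : nth IHalt P (_ + 7) = _) addnA addn1.
  + by rewrite /= /upd eqxx V2 V1 F2 ?F1 ?hR //; apply: loc_tmp; lia.
  + by move=> j hj; rewrite /= /upd neq_tmp // F2 // F1.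
- move=> he hR /code_at_cat[h1 /code_at_cons[h3 _]].
  have [R1 [S1 V1 F1]] := IH _ _ _ he hR h1.
  eexists; split.
  + rewrite size_cat; apply: reach_trans S1 _; apply: reach1.
    by rewrite /step /= h3 /= addn1 addnS.
  + by rewrite /upd eqxx V1.
  + by move=> j hj; rewrite /upd neq_tmp // F1.
- move=> /andP[he1 he2] hR /code_at_cat[h1 /code_at_cat[h2 /code_at_cons[h3 _]]].
  have [R1 [S1 V1 F1]] := IH1 _ _ _ he1 hR h1.
  have [R2 [S2 V2 F2]] := IH2 _ _ _ he2 (agree_frame _ _ _ _ F1 hR) h2.
  eexists; split.
  + rewrite size_cat; apply: reach_trans S1 _; rewrite size_cat addnA.
    apply: reach_trans S2 _; apply: reach1.
    by rewrite /step /= h3 /= addn1 addnS.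
  + rewrite /upd eqxx V2 F2 ?V1 //.
    by move=> [d' hd E]; move: E hd; rewrite /loc /stride; lia.
  + by move=> j hj; rewrite /upd neq_tmp // F2 ?F1 //; apply: up.
- move=> /andP[he1 he2] hR /code_at_cat[h1 /code_at_cat[h2 /code_at_cons[h3 _]]].
  have [R1 [S1 V1 F1]] := IH1 _ _ _ he1 hR h1.
  have [R2 [S2 V2 F2]] := IH2 _ _ _ he2 (agree_frame _ _ _ _ F1 hR) h2.
  eexists; split.
  + rewrite size_cat; apply: reach_trans S1 _; rewrite size_cat addnA.
    apply: reach_trans S2 _; apply: reach1.
    by rewrite /step /= h3 /= addn1 addnS.
  + rewrite /upd eqxx V2 F2 ?V1 //.
    by move=> [d' hd E]; move: E hd; rewrite /loc /stride; lia.
  + by move=> j hj; rewrite /upd neq_tmp // F2 ?F1 //; apply: up.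
Qed.

Lemma ctr_frame d d' (R1 R2 : nat -> nat) :
  (forall j, ~ is_tmp d j -> R2 j = R1 j) -> R2 (ctr d') = R1 (ctr d').
Proof. by apply; apply: loc_tmp. Qed.

Lemma eval_bound s k1 k2 : eval inp s (bound_expr k1 k2) = bound inp k1 k2.
Proof. by rewrite /bound; elim: k1 => //= k1 ->; rewrite mulSn addnA. Qed.

Lemma wf_bound k1 k2 : expr_wf (bound_expr k1 k2).
Proof. by elim: k1. Qed.

Lemma gotoP p t R : code_at P p (goto t) ->
  exists2 R', reach p R 2 t R' & forall j, ~ is_tmp 0 j -> R' j = R j.
Proof.
move=> /code_at_cons[h1 /code_at_cons[h2 _]]; eexists.
  by rewrite /reach /= /step /= h1 /= h2 /=.
by move=> j hj; rewrite /upd ifN //; apply/eqP=> E; apply: hj; exists 0.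
Qed.

(** The clause on counters carries the induction through nested loops: a body compiled at depth
    [d.+1] leaves the surrounding counter intact. The loop variable is a mere copy of that counter,
    so the body may overwrite it. *)
Lemma ccomP c s p d R : com_wf c -> agree R s -> code_at P p (ccom c p d) ->
  exists t R', [/\ reach p R t (p + csize c) R', t <= cost (nth 0 inp 0) c,
    agree R' (sem inp c s) & forall d', d' < d -> R' (ctr d') = R (ctr d')].
Proof.
elim: c s p d R => [|a e1 e2|c1 IH1 c2 IH2|e c1 IH1 c2 IH2|k1 k2 a i b IH] s p d R.
- by move=> _ hR _; exists 0, R; rewrite addn0; split.
- move=> /and3P[ha he1 he2] hR.
  rewrite /ccom -/ccom => /code_at_cat[h1 /code_at_cat[h2 /code_at_cat[h3 /code_at_cons[h4 _]]]].
  have [R1 [S1 V1 F1]] := cexpP _ _ _ _ _ he1 hR h1.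
  have [R2 [S2 V2 F2]] := to_addrP _ _ _ R1 h2.
  have hR2 : agree R2 s by apply: agree_frame F2 _; apply: agree_frame F1 hR.
  have [R3 [S3 V3 F3]] := cexpP _ _ _ _ _ he2 hR2 h3.
  have V3' : R3 (tmp 0) = loc a (eval inp s e1).
    rewrite F3 ?V2 ?V1 //.
    by move=> [d' hd E]; move: E hd; rewrite /loc /stride; lia.
  eexists _, _; split.
  + rewrite /csize; apply: reach_trans S1 _; rewrite addnA.
    apply: reach_trans S2 _; rewrite addnA; apply: reach_trans S3 _.
    apply: reach1; rewrite /step /pc addnA (h4 : nth IHalt P (_ + 7 + _) = _).
    by rewrite addn1.
  + by [].
  + rewrite /= V3' V3 => b j hb; rewrite /upd /set_cell.
    have [E|ne] := eqVneq (loc b j) (loc a (eval inp s e1)).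
      have [||-> ->] := loc_inj _ _ _ _ _ _ E; [lia|lia|by rewrite !eqxx].
    rewrite F3 ?hR2 //; last by apply: loc_tmp; lia.
    case: eqVneq => // E; subst b; case: eqVneq => // E; subst j.
    by rewrite eqxx in ne.
  + move=> d' _; rewrite /= V3' /upd ifN; last first.
      by apply: loc_neq; lia.
    by rewrite (ctr_frame _ _ _ _ F3) (ctr_frame _ _ _ _ F2) (ctr_frame _ _ _ _ F1).
- move=> /andP[w1 w2] hR /= /code_at_cat[h1]; rewrite size_ccom => h2.
  have [t1 [R1 [S1 T1 A1 F1]]] := IH1 _ _ _ _ w1 hR h1.
  have [t2 [R2 [S2 T2 A2 F2]]] := IH2 _ _ _ _ w2 A1 h2.
  exists (t1 + t2), R2; split=> //.
  + by rewrite addnA; apply: reach_trans S1 S2.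
  + by rewrite leq_add.
  + by move=> d' hd; rewrite F2 ?F1.
- move=> /and3P[we w1 w2] hR /=.
  set p1 := p + _ + 1; set p2 := p1 + _ + 2.
  move=> /code_at_cat[h1 /code_at_cons[h2]]; rewrite -addn1 -/p1.
  move=> /code_at_cat[h3]; rewrite size_ccom.
  move=> /(code_at_cat P _ (goto (p2 + csize c2)) (ccom c2 p2 d))[h4].
  rewrite -[_ + size (goto _)]/p2 => h5.
  have [R1 [S1 V1 F1]] := cexpP _ _ _ _ _ we hR h1.
  have hR1 : agree R1 s by apply: agree_frame F1 hR.
  rewrite -V1; have [E|NE] /= := eqVneq (R1 (tmp 0)) 0.
  + have [t2 [R2 [S2 T2 A2 F2]]] := IH2 _ _ _ _ w2 hR1 h5.
    exists (size (cexp e 0) + (1 + t2)), R2; split=> //.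
    * apply: reach_trans S1 _; apply: (@reach_trans _ _ _ p2 R1).
        by apply: reach1; rewrite /step /= h2 /= E.
      by congr (reach _ _ _ _ _): S2; rewrite /p2 /p1; lia.
    * lia.
    * by move=> d' hd; rewrite F2 // (ctr_frame _ _ _ _ F1).
  + have [t2 [R2 [S2 T2 A2 F2]]] := IH1 _ _ _ _ w1 hR1 h3.
    have [R3 S3 F3] := gotoP _ _ R2 h4.
    exists (size (cexp e 0) + (1 + (t2 + 2))), R3; split=> //.
    * apply: reach_trans S1 _; apply: (@reach_trans _ _ _ p1 R1).
        by apply: reach1; rewrite /step /= h2 /= (negbTE NE) /p1 addn1.
      apply: reach_trans S2 _.
      by congr (reach _ _ _ _ _): S3; rewrite /p2 /p1; lia.
    * lia.
    * by apply: agree_frame F3 A2.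
    * by move=> d' hd; rewrite (ctr_frame _ _ _ _ F3) F2 // (ctr_frame _ _ _ _ F1).
- move=> /andP[ha wb] hR /=.
  set be := cexp _ _; set p1 := p + 1 + _ + 4; rewrite -cat1s.
  move=> /code_at_cat[/code_at_cons[h0 _] /code_at_cat[hb]].
  set q := p + size _ + size be.
  move=> /code_at_cons[h1 /code_at_cons[h2 /code_at_cons[h3 /code_at_cons[h4]]]].
  rewrite /= (_ : q.+4 = p1); last by rewrite /q /p1 /=; lia.
  move=> /code_at_cat[h5]; rewrite size_ccom.
  move=> /code_at_cons[h6 /code_at_cons[h7 h8]].
  set N := bound inp k1 k2.
  (* Generalised to a loop at counter value [k] with [j] rounds left; the factor [j.+1] also pays
     for the test that leaves the loop. *)
  have iters j s1 R1 k : k + j = N -> agree R1 s1 -> R1 (ctr d) = k ->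
     exists t R2, [/\ reach p.+1 R1 t (p1 + csize b + 4) R2,
       t <= j.+1 * (size be + 8 + cost (nth 0 inp 0) b),
       agree R2 (foldl (fun s t => sem inp b (set_cell s a i t)) s1 (iota k j))
       & forall d', d' < d -> R2 (ctr d') = R1 (ctr d')].
    elim: j s1 R1 k => [|j IHj] s1 R1 k kj A1 C1.
      have hb' : code_at P p.+1 be by move: hb; rewrite /= addn1.
      have [R2 [S2 V2 F2]] := cexpP _ _ _ _ _ (wf_bound k1 k2) A1 hb'.
      rewrite eval_bound -/N -/be in V2 S2.
      eexists (size be + (1 + 1)), _; split.
      - apply: reach_trans S2 _; rewrite (_ : p.+1 + size be = q) 1?/q /=; last lia.
        apply: reach_trans; first by apply: reach1; rewrite /step /= h1.
        apply: reach1; rewrite /step /= h2 /= /upd eqxx V2 (ctr_frame _ _ _ _ F2) C1.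
        by rewrite (_ : N - k = 0); last lia.
      - lia.
      - move=> b0 j0 hb0; rewrite /upd ifN; first exact: (agree_frame _ _ _ _ F2 A1).
        by apply: loc_neq; lia.
      - move=> d' _; rewrite /upd ifN; first exact: (ctr_frame _ _ _ _ F2).
        by apply: loc_neq; lia.
    have hb' : code_at P p.+1 be by move: hb; rewrite /= addn1.
    have [R2 [S2 V2 F2]] := cexpP _ _ _ _ _ (wf_bound k1 k2) A1 hb'.
    rewrite eval_bound -/N -/be in V2 S2.
    pose R3 := upd (upd (upd R2 (tmp 0) (N - k)) (tmp 1) 0) (loc a i) k.
    have C2 : R2 (ctr d) = k by rewrite (ctr_frame _ _ _ _ F2).
    have S3 : reach p.+1 R1 (size be + (1 + (1 + (1 + 1)))) p1 R3.
      apply: reach_trans S2 _; rewrite (_ : p.+1 + size be = q) 1?/q /=; last lia.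
      apply: reach_trans; first by apply: reach1; rewrite /step /= h1.
      apply: reach_trans.
        apply: reach1; rewrite /step /= h2 /= {1}/upd eqxx V2 C2.
        by rewrite (_ : (N - k == 0) = false); last by apply/eqP; lia.
      apply: reach_trans; first by apply: reach1; rewrite /step /= h3.
      apply: reach1; rewrite /step /= h4 /=.
      congr RamState; first by rewrite /q /p1 /=; lia.
      rewrite /R3; congr (upd _ _ _); rewrite /upd eqxx addn0.
      have /negbTE -> : ctr d != tmp 1 by apply: loc_neq; lia.
      have /negbTE -> : ctr d != tmp 0 by apply: loc_neq; lia.
      by rewrite C2.
    have A3 : agree R3 (set_cell s1 a i k).
      move=> b0 j0 hb0; rewrite /R3 /upd /set_cell.
      have [E|ne] := eqVneq (loc b0 j0) (loc a i).
        have [||-> ->] := loc_inj _ _ _ _ _ _ E; [lia|lia|by rewrite !eqxx].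
      rewrite ifN; last by apply: loc_neq; lia.
      rewrite ifN; last by apply: loc_neq; lia.
      rewrite (agree_frame _ _ _ _ F2 A1) //.
      case: eqVneq => // E; subst b0; case: eqVneq => // E; subst j0.
      by rewrite eqxx in ne.
    have C3 d' : R3 (ctr d') = R1 (ctr d').
      rewrite /R3 /upd.
      rewrite ifN; last by apply: loc_neq; lia.
      rewrite ifN; last by apply: loc_neq; lia.
      rewrite ifN; last by apply: loc_neq; lia.
      exact: (ctr_frame _ _ _ _ F2).
    have [t4 [R4 [S4 T4 A4 F4]]] := IH _ _ _ _ wb A3 h5.
    pose R5 := upd (upd R4 (tmp 0) 1) (ctr d) k.+1.
    have S5 : reach (p1 + csize b) R4 (1 + 1) (p1 + csize b).+2 R5.
      apply: reach_trans; first by apply: reach1; rewrite /step /= h6.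
      apply: reach1; rewrite /step /= h7 /=.
      rewrite /R5 /upd eqxx.
      have /negbTE -> : ctr d != tmp 0 by apply: loc_neq; lia.
      by rewrite F4 // C3 C1 addn1.
    have [R6 S6 F6] := gotoP _ _ R5 h8.
    have A6 : agree R6 (sem inp b (set_cell s1 a i k)).
      apply: agree_frame F6 _ => b0 j0 hb0; rewrite /R5 /upd.
      rewrite ifN; last by apply: loc_neq; lia.
      rewrite ifN; last by apply: loc_neq; lia.
      exact: A4.
    have C6 : R6 (ctr d) = k.+1.
      by rewrite (ctr_frame _ _ _ _ F6) /R5 /upd eqxx.
    have kj' : k.+1 + j = N by lia.
    have [t7 [R7 [S7 T7 A7 F7]]] := IHj _ _ _ kj' A6 C6.
    exists (size be + (1 + (1 + (1 + 1))) + (t4 + (1 + 1 + (2 + t7)))), R7; split=> //.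
    - apply: reach_trans S3 _; apply: reach_trans S4 _; apply: reach_trans S5 _.
      by apply: reach_trans S6 _.
    - by move: T7 T4; rewrite !mulSn; lia.
    - move=> d' hd; rewrite F7 // (ctr_frame _ _ _ _ F6) /R5 /upd.
      rewrite ifN; last by apply: loc_neq; lia.
      rewrite ifN; last by apply: loc_neq; lia.
      by rewrite F4 ?C3 // ltnW.
  pose R0 := upd R (ctr d) 0.
  have S0 : reach p R 1 p.+1 R0 by apply: reach1; rewrite /step /= h0.
  have A0 : agree R0 s.
    move=> b0 j0 hb0; rewrite /R0 /upd ifN; first exact: hR.
    by apply: loc_neq; lia.
  have C0 : R0 (ctr d) = 0 by rewrite /R0 /upd eqxx.
  have [t7 [R7 [S7 T7 A7 F7]]] := iters _ _ _ _ (add0n N) A0 C0.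
  exists (1 + t7), R7; split=> //.
  + apply: reach_trans S0 _; rewrite (_ : p + _ = p1 + csize b + 4) //.
    by rewrite /p1; lia.
  + by move: T7; rewrite /N /bound; nia.
  + move=> d' hd; rewrite F7 // /R0 /upd ifN //.
    by apply: loc_neq; lia.
Qed.

(** At a halted state [step] is the identity, so running too long does no harm. *)
Lemma exec_iter t s : exec P inp t s = iter t (step P inp) s.
Proof.
elim: t s => // t IH s; rewrite iterSr /= -IH /halted.
have: nth IHalt P (pc s) = IHalt -> exec P inp t (step P inp s) = s.
  move=> h; have E : step P inp s = s by rewrite /step h.
  by rewrite E; case: (t) => //= t'; rewrite /halted h.
by case: nth => // /(_ erefl) ->.
Qed.

End Simulation.

Fixpoint depth (c : com) : nat :=
  match c with
  | Skip | Asg _ _ _ => 0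
  | Seq c1 c2 | If _ c1 c2 => maxn (depth c1) (depth c2)
  | Loop _ _ _ _ b => (depth b).+1
  end.

Lemma cost_bound c : exists K, forall n, cost n c <= K * n.+1 ^ depth c.
Proof.
have mono K D D' n : D <= D' -> K * n.+1 ^ D <= K * n.+1 ^ D'.
  by move=> h; rewrite leq_mul2l leq_pexp2l ?orbT.
elim: c => [|a e1 e2|c1 [K1 H1] c2 [K2 H2]|e c1 [K1 H1] c2 [K2 H2]|k1 k2 a i b [K H]].
- by exists 0.
- by exists (csize (Asg a e1 e2)) => n; rewrite muln1.
- exists (K1 + K2) => n /=; rewrite mulnDl leq_add //.
    by apply: leq_trans (H1 n) (mono _ _ _ _ (leq_maxl _ _)).
  by apply: leq_trans (H2 n) (mono _ _ _ _ (leq_maxr _ _)).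
- exists (size (cexp e 0) + 3 + K1 + K2) => n /=; rewrite !mulnDl -mulnDl !leq_add //.
  + by rewrite -[leqLHS]muln1 leq_mul2l expn_gt0 orbT.
  + by apply: leq_trans (H1 n) (mono _ _ _ _ (leq_maxl _ _)).
  + by apply: leq_trans (H2 n) (mono _ _ _ _ (leq_maxr _ _)).
- set S := size (cexp (bound_expr k1 k2) 0) + 9.
  exists ((k1 + k2 + 1) * (S + K)) => n /=; rewrite -/S expnS mulnACA.
  apply: leq_mul; first nia.
  rewrite mulnDl leq_add ?H //.
  by rewrite -[leqLHS]muln1 leq_mul2l expn_gt0 orbT.
Qed.

(* Register 0 is the bottom of the temporary stack, so the value of [out]
   ends up there. *)
Lemma compile_correct (c : com) (out : expr) :
  com_wf c -> expr_wf out ->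
  exists (P : program) (K : nat), forall inp : seq nat,
    runs_within P inp (K * (nth 0 inp 0).+1 ^ depth c)
      (eval inp (sem inp c (fun _ _ => 0)) out).
Proof.
move=> wc wo; have [K HK] := cost_bound c.
pose P := ccom c 0 0 ++ cexp out 0 ++ [:: IHalt].
exists P, (K + size (cexp out 0)) => inp.
have : code_at P 0 P by move=> k; rewrite add0n.
rewrite {2}/P => /code_at_cat[hc /code_at_cat[ho /code_at_cons[hh _]]].
rewrite size_ccom in ho hh.
have A0 : agree (fun _ => 0) (fun _ _ => 0) by [].
have [t1 [R1 [S1 T1 A1 _]]] := ccomP _ inp _ _ _ _ _ wc A0 hc.
have [R2 [S2 V2 _]] := cexpP P inp _ _ _ _ _ wo A1 ho.
have S := reach_trans _ _ _ _ _ _ _ _ _ _ S1 S2.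
set T := (_ * _); set t := (t1 + _) in S.
have hT : t <= T.
  rewrite /t /T mulnDl leq_add //; first by apply: leq_trans T1 (HK _).
  by rewrite -[leqLHS]muln1 leq_mul2l expn_gt0 orbT.
have halt : step P inp (RamState (0 + csize c + size (cexp out 0)) R2) =
    RamState (0 + csize c + size (cexp out 0)) R2 by rewrite /step /= hh.
have E : exec P inp T init_state = RamState (0 + csize c + size (cexp out 0)) R2.
  rewrite exec_iter -(subnK hT) iterD.
  rewrite [X in iter _ _ X](S : iter t _ (init_state) = _).
  by elim: (T - t) => //= k ->.
by rewrite /runs_within E /halted /= hh.
Qed.

(** * Crossing numbers on closed walks *)

Section Windings.
Variable m : nat.
Implicit Types (q : 'I_m -> int) (r : 'I_m -> 'I_m).

(* The token at position [x] of a closed walk of length [m] has to reach position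
   [r x] after [q x] turns, i.e. position [r x + q x * m] of the universal cover.
   The winding of [x] and [y] is the signed number of times they cross. *)
Definition winding q r (x y : 'I_m) : int :=
  (q y - q x - Posz (r y < r x)%N + Posz (y < x)%N)%R.

(* Ordered pairs are summed, so every crossing is counted twice. *)
Definition crossings q r : nat := \sum_x \sum_y `|winding q r x y|%N.

Definition cyclic_edge (wrap : bool) (x y : 'I_m) : bool :=
  if wrap then (x.+1 == m) && (y == 0 :> nat) && (x != y) else y == x.+1 :> nat.

(** The wrap edge crosses the seam between positions m-1 and 0: the token arriving at [x0] has moved
    backwards over it and owes one more turn, the one arriving at [y0] owes one less. *)
Definition swap_q (wrap : bool) x0 y0 q : 'I_m -> int :=
  fun z => (q (tperm x0 y0 z) + Posz (wrap && (z == x0)) - Posz (wrap && (z == y0)))%R.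

Definition swap_r x0 y0 r : 'I_m -> 'I_m := fun z => r (tperm x0 y0 z).

Lemma cyclic_edge_neq wrap x y : cyclic_edge wrap x y -> x != y.
Proof. by case: wrap => /=; [case/andP|apply: contraL => /eqP ->; lia]. Qed.

(** Windings belong to tokens, which now stand at the images under [tperm x0 y0]; only the two that
    trade places change their order in the universal cover. *)
Lemma winding_swap wrap x0 y0 q r x y : cyclic_edge wrap x0 y0 ->
  winding (swap_q wrap x0 y0 q) (swap_r x0 y0 r)
    (tperm x0 y0 x) (tperm x0 y0 y) =
  (winding q r x y + Posz ((x == x0) && (y == y0)) - Posz ((x == y0) && (y == x0)))%R.
Proof.
move=> E; have ne := cyclic_edge_neq _ _ _ E.
rewrite /winding /swap_q /swap_r !tpermK.
have vne : (x0 : nat) <> y0 by move/val_inj => h; rewrite h eqxx in ne.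
have tp z : (tperm x0 y0 z : nat) =
    if z == x0 :> nat then y0 : nat else if z == y0 :> nat then x0 : nat else z.
  by case: tpermP => [->|->|/eqP h1 /eqP h2]; rewrite ?eqxx //;
    [case: eqP => // ->|rewrite !val_eqE (negbTE h1) (negbTE h2)].
move: E; rewrite /cyclic_edge -!val_eqE /= !tp -?val_eqE /=; have := ltn_ord x; have := ltn_ord y.
move: (ltn_ord x0) (ltn_ord y0).
move: vne.
move: (x : nat) (y : nat) (x0 : nat) (y0 : nat) => X Y X0 Y0 vne lx0 ly0 lY lX.
case: wrap => /= E.
- have {E}[E0 EY] : X0.+1 = m /\ Y0 = 0 by move: E; lia.
  subst Y0; case: (eqVneq X X0) => hx; case: (eqVneq Y X0) => hy;
  case: (eqVneq X 0) => hx0; case: (eqVneq Y 0) => hy0 /=; lia.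
- move/eqP: E => ->; case: (eqVneq X X0) => hx; case: (eqVneq Y X0) => hy;
  case: (eqVneq X X0.+1) => hx0; case: (eqVneq Y X0.+1) => hy0 /=; lia.
Qed.

Lemma winding_anti q r x y : injective r -> winding q r y x = (- winding q r x y)%R.
Proof.
move=> ir; rewrite /winding; have [->|ne] := eqVneq x y; first by lia.
have : (x : nat) <> y by move/val_inj=> h; rewrite h eqxx in ne.
have : (r x : nat) <> r y by move/val_inj/ir => h; rewrite h eqxx in ne.
lia.
Qed.

(** The additive form serves both directions: a swap at a negative winding saves 2, and any swap
    costs at most 2. The 2 comes from the two orders of the pair. *)
Lemma crossings_swapE wrap x0 y0 q r : injective r -> cyclic_edge wrap x0 y0 ->
  crossings (swap_q wrap x0 y0 q) (swap_r x0 y0 r) + `|winding q r x0 y0|.*2 =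
  crossings q r + `|(winding q r x0 y0 + 1)%R|.*2.
Proof.
move=> ir E; have ne := cyclic_edge_neq _ _ _ E.
rewrite /crossings (reindex_inj (@perm_inj _ (tperm x0 y0))) /=.
under eq_bigr => x _ do rewrite (reindex_inj (@perm_inj _ (tperm x0 y0))) /=.
under eq_bigr => x _ do under eq_bigr => y _ do rewrite winding_swap //.
rewrite !pair_big /=.
have neyx : (y0, x0) != (x0, y0) by rewrite xpair_eqE (eq_sym y0) (negbTE ne).
rewrite (bigD1 (x0, y0)) //= (bigD1 (y0, x0)) //=.
rewrite [in RHS](bigD1 (x0, y0)) //= [in RHS](bigD1 (y0, x0)) //=.
rewrite (eq_bigr (fun p => `|winding q r p.1 p.2|%N)); last first.
  case=> x y /=; rewrite !xpair_eqE => /andP[/negbTE -> /negbTE ->].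
  by congr absz; lia.
rewrite !eqxx (eq_sym y0) (negbTE ne) /= (winding_anti _ _ x0 y0) //.
lia.
Qed.

Lemma swap_q_sum wrap x0 y0 q : cyclic_edge wrap x0 y0 ->
  (\sum_z swap_q wrap x0 y0 q z = \sum_z q z)%R.
Proof.
move=> E; rewrite /swap_q !big_split /= (reindex_inj (@perm_inj _ (tperm x0 y0))) /=.
under eq_bigr => x _ do rewrite tpermK.
suff ind z0 : (\sum_(z : 'I_m) Posz (wrap && (z == z0)) = Posz wrap)%R.
  by rewrite sumrN !ind addrK.
rewrite (bigD1 z0) //= eqxx andbT big1 ?addr0 // => z /negbTE ->.
by rewrite andbF.
Qed.

Lemma swap_r_inj x0 y0 r : injective r -> injective (swap_r x0 y0 r).
Proof. by move=> ir x y /ir /perm_inj. Qed.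

(** Nonnegative windings of neighbours make [q] nondecreasing, and the one at the seam bounds the
    last value by the first plus 1. Sum 0 then leaves only the zero function. *)
Lemma no_descent_q q r : injective r -> (\sum_z q z = 0)%R ->
  (forall x y, cyclic_edge false x y -> (0 <= winding q r x y)%R) ->
  ((forall x, q x = 0%R) \/
   (forall x y, cyclic_edge true x y -> (0 <= winding q r x y)%R)) ->
  forall x, q x = 0%R.
Proof.
move=> ir sq up [//|wr].
have mono (x y : 'I_m) : x <= y -> (q x <= q y)%R.
  move=> xy; have [d Ed] : exists d, (y : nat) = x + d by exists (y - x); lia.
  elim: d y Ed {xy} => [|d IH] y Ed.
    by rewrite (_ : x = y) //; apply: val_inj; rewrite /= Ed addn0.
  have hd : x + d < m by have := ltn_ord y; lia.
  apply: (le_trans (IH (Ordinal hd) erefl)).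
  have := up (Ordinal hd) y; rewrite /cyclic_edge /winding /= Ed addnS eqxx.
  by move/(_ isT); lia.
case: (posnP m) => [m0|m_gt0]; first by case=> x hx; exfalso; lia.
have hl : m.-1 < m by lia.
pose z0 := Ordinal m_gt0; pose zl := Ordinal hl.
have q0l : (q zl <= q z0 + 1)%R.
  have [E|ne] := eqVneq zl z0; first by rewrite E; lia.
  have := wr zl z0; rewrite /cyclic_edge ne /= prednK // eqxx => /(_ isT).
  rewrite /winding /=; lia.
have lb x : (q z0 <= q x)%R by apply: mono.
have ub x : (q x <= q zl)%R by apply: mono; have := ltn_ord x; rewrite /=; lia.
have z00 : q z0 = 0%R.
  apply: le_anti; apply/andP; split.
  - rewrite leNgt; apply/negP => h; have : (0 < \sum_z q z)%R; last by rewrite sq.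
    rewrite (bigD1 z0) //=; apply: ltr_pwDl => //; apply: sumr_ge0 => x _.
    by have := lb x; lia.
  - rewrite leNgt; apply/negP => h; have : (\sum_z q z < 0)%R; last by rewrite sq.
    rewrite (bigD1 z0) //=; apply: ltr_nwDl => //; apply: sumr_le0 => x _.
    by have := ub x; lia.
have ge0 x : (0 <= q x)%R by rewrite -z00.
move=> x; have /eqP := sq; rewrite psumr_eq0 // => /allP /(_ x (mem_index_enum _)).
by move/eqP.
Qed.

(** Without turns, nonnegative windings of neighbours make [r] strictly increasing, and such a
    self-map of a finite interval is the identity. *)
Lemma no_descent_id q r : injective r -> (forall x, q x = 0%R) ->
  (forall x y, cyclic_edge false x y -> (0 <= winding q r x y)%R) ->
  forall x, r x = x.
Proof.
move=> ir q0 up.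
have inc (x y : 'I_m) : (y : nat) = x.+1 -> r x < r y.
  move=> E; have := up x y; rewrite /cyclic_edge E eqxx /winding !q0 => /(_ isT).
  have : (r x : nat) <> r y by move/val_inj/ir => h; move: E; rewrite h; lia.
  lia.
have lo k (hk : k < m) : k <= r (Ordinal hk).
  elim: k hk => // k IH hk; have hk' : k < m by lia.
  by apply: leq_ltn_trans (IH hk') _; apply: inc.
have hi k (hk : m.-1 - k < m) : k < m -> r (Ordinal hk) <= m.-1 - k.
  elim: k hk => [|k IH] hk km; first by have := ltn_ord (r (Ordinal hk)); lia.
  have hk' : m.-1 - k < m by lia.
  have h1 := IH hk' ltac:(lia).
  have := inc (Ordinal hk) (Ordinal hk'); rewrite /= => /(_ ltac:(lia)); lia.
move=> x; apply: val_inj => /=; apply/eqP; rewrite eqn_leq; apply/andP; split.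
- have hx := ltn_ord x; have hk : m.-1 - (m.-1 - x) < m by lia.
  have := hi _ hk ltac:(lia); rewrite (_ : Ordinal hk = x); first lia.
  by apply: val_inj => /=; lia.
- by have := lo x (ltn_ord x); rewrite (_ : Ordinal _ = x) //; apply: val_inj.
Qed.

End Windings.

(** * Ranks within colour classes, and fluxes *)

Section Ranks.
Variable m : nat.
Implicit Types (a b : 'I_m -> nat) (q : 'I_m -> int) (r : 'I_m -> 'I_m).

Definition rank a (x : 'I_m) : nat := \sum_(z < m) ((z < x) && (a z == a x)).
Definition mult a (x : 'I_m) : nat := \sum_(z < m) (a z == a x).

Lemma rank_lt_mult a x : rank a x < mult a x.
Proof.
rewrite /rank /mult (bigD1 x) //= ltnn add0n [ltnRHS](bigD1 x) //= eqxx add1n ltnS.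
by apply: leq_sum => z _; case: (z < x).
Qed.

Lemma mult_le a x : mult a x <= m.
Proof.
rewrite -[leqRHS]card_ord -sum1_card.
by apply: leq_sum => z _; case: (_ == _).
Qed.

Lemma rank_mono a x y : a x = a y -> x < y -> rank a x < rank a y.
Proof.
move=> axy xy; rewrite /rank (bigD1 x) //= ltnn add0n [ltnRHS](bigD1 x) //=.
rewrite xy axy eqxx add1n ltnS; apply: leq_sum => z _.
by case: ltnP => //= zx; rewrite (ltn_trans zx xy).
Qed.

Lemma rank_inj a x y : a x = a y -> rank a x = rank a y -> x = y.
Proof.
move=> axy E; apply: val_inj; apply/eqP; case: ltngtP => // h.
- by have := rank_mono _ _ _ axy h; rewrite E ltnn.
- by have := rank_mono _ _ _ (esym axy) h; rewrite E ltnn.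
Qed.

Lemma rank_lt a x y : a x = a y -> (rank a x < rank a y) = (x < y).
Proof.
move=> axy; case: (ltngtP x y) => h; first exact: rank_mono.
- by apply/negbTE; rewrite -leqNgt; apply/ltnW/rank_mono.
- by rewrite (val_inj h) ltnn.
Qed.

(** Ranks map the colour class injectively into the numbers below its size, so they hit all of
    them. *)
Lemma rank_onto b y0 v : v < mult b y0 -> exists2 y, b y = b y0 & rank b y = v.
Proof.
move=> hv.
have rkm y : rank b y < m by apply: leq_trans (rank_lt_mult b y) (mult_le b y).
pose S := [set y | b y == b y0]; pose rk y := Ordinal (rkm y).
pose T := [set u : 'I_m | u < mult b y0].
have cS : #|S| = mult b y0.
  by rewrite -sum1_card /mult big_mkcond /=; apply: eq_bigr => z _; rewrite inE; case: (_ == _).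
have cT : #|T| <= mult b y0.
  have E : \sum_(u < m | u < mult b y0) 1 = mult b y0.
    by rewrite -(big_ord_widen m (fun=> 1) (mult_le b y0)) sum1_card card_ord.
  by rewrite -[leqRHS]E -sum1_card; apply: eq_leq; apply: eq_bigl => u; rewrite inE.
have sub : rk @: S \subset T.
  apply/subsetP => _ /imsetP[y + ->]; rewrite !inE /= => /eqP by0.
  by apply: leq_trans (rank_lt_mult b y) _; rewrite /mult by0.
have cI : #|rk @: S| = #|S|.
  apply: card_in_imset => y z; rewrite !inE => /eqP hy /eqP hz [E].
  by apply: rank_inj E; rewrite hy hz.
have /eqP E : rk @: S == T by rewrite eqEcard sub cI cS.
have : Ordinal (leq_trans hv (mult_le b y0)) \in T by rewrite inE.
rewrite -E => /imsetP[y]; rewrite inE => /eqP hy [hr].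
by exists y.
Qed.

Definition flux a q (c : nat) : int := (\sum_(z | a z == c) q z)%R.

Definition order_preserving a q r :=
  forall x y, a x = a y -> winding m q r x y = 0%R.

(* Summing the vanishing windings over the colour class of [x]. *)
Lemma rank_formula a b q r x : injective r -> (forall z, b (r z) = a z) ->
  order_preserving a q r ->
  (Posz (mult a x) * q x + Posz (rank b (r x)) = flux a q (a x) + Posz (rank a x))%R.
Proof.
move=> ir br op.
have : (\sum_(z | a z == a x) winding m q r x z = 0)%R.
  by apply: big1 => z /eqP h; apply: op.
have sumZ (F : 'I_m -> nat) (p : pred 'I_m) :
    (\sum_(z | p z) Posz (F z) = Posz (\sum_(z | p z) F z))%R.
  by rewrite (big_morph Posz PoszD (erefl 0%R)).
rewrite /winding !big_split /= !sumrN !sumZ -/(flux a q (a x)).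
have -> : (\sum_(z | a z == a x) q x = Posz (mult a x) * q x)%R.
  rewrite sumr_const -mulr_natl; congr (_ * _)%R; rewrite natz /mult -sum1_card.
  congr Posz; rewrite big_mkcond; apply: eq_bigr => z _; rewrite unfold_in.
  by rewrite -[eqn _ _]/(a z == a x); case: (_ == _).
have -> : \sum_(z | a z == a x) (z < x) = rank a x.
  by rewrite /rank big_mkcond; apply: eq_bigr => z _; rewrite andbC; case: (_ == _).
have -> : \sum_(z | a z == a x) (r z < r x) = rank b (r x).
  rewrite /rank [RHS](reindex_inj ir) [LHS]big_mkcond; apply: eq_bigr => z _.
  by rewrite !br andbC; case: (_ == _).
lia.
Qed.

(** As [q] sums to 0, -m times the flux is the sum of q y - q x over x in the class and all y; each
    difference is within 1 of a winding. *)
Lemma flux_bound a q r c : (\sum_z q z = 0)%R ->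
  m * `|flux a q c| <= crossings m q r + m * m.
Proof.
move=> sq.
have E : (- (flux a q c *+ m) = \sum_(x | a x == c) \sum_y (q y - q x))%R.
  transitivity (\sum_(x | a x == c) (- (q x *+ m)))%R.
    by rewrite sumrN -sumrMnl.
  by apply: eq_bigr => x _; rewrite sumrB sq sumr_const card_ord sub0r.
rewrite -[m * _]absz_nat PoszM -{1}[`|flux a q c|]absz_nat.
have -> : `|(Posz m * Posz `|flux a q c|)%R| = `|(- (flux a q c *+ m))%R|.
  by rewrite -mulr_natl abszN !abszM natz !absz_nat.
rewrite E.
have abs_sum (I : finType) (p : pred I) (F : I -> int) :
   `|(\sum_(i | p i) F i)%R| <= \sum_(i | p i) `|F i|.
  elim/big_ind2: _ => // u v u' v' h h'; lia.
apply: leq_trans (abs_sum _ _ _) _.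
have -> : m * m = \sum_(x < m) \sum_(y < m) 1.
  by rewrite !sum_nat_const card_ord muln1.
rewrite -big_split /= big_mkcond /=; apply: leq_sum => x _.
case: ifP => // _; apply: leq_trans (abs_sum _ _ _) _; rewrite -big_split /=.
by apply: leq_sum => y _; rewrite /winding; lia.
Qed.

(** Send the k-th token of each colour to the k-th place of that colour. Without turns every winding
    is at most 1 in absolute value. *)
Lemma order_preserving_base a b r0 : injective r0 -> (forall z, b (r0 z) = a z) ->
  exists r, [/\ injective r, forall z, b (r z) = a z,
    order_preserving a (fun=> 0%R) r & crossings m (fun=> 0%R) r <= m * m].
Proof.
move=> ir br.
have ex x : exists y, (b y == a x) && (rank b y == rank a x).
  have h : rank a x < mult b (r0 x).
    apply: leq_trans (rank_lt_mult a x) _; rewrite /mult [leqRHS](reindex_inj ir).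
    by apply: leq_sum => z _; rewrite !br.
  by have [y h1 h2] := rank_onto _ _ _ h; exists y; rewrite h1 br h2 !eqxx.
pose r x := xchoose (ex x).
have rP x : b (r x) = a x /\ rank b (r x) = rank a x.
  by have /andP[/eqP ? /eqP ?] := xchooseP (ex x).
have ir' : injective r.
  move=> x y E; apply: (rank_inj a); first by rewrite -!(proj1 (rP _)) E.
  by rewrite -!(proj2 (rP _)) E.
exists r; split=> //; first by move=> z; case: (rP z).
- move=> x y axy; rewrite /winding -(rank_lt b); last by rewrite !(proj1 (rP _)).
  by rewrite !(proj2 (rP _)) rank_lt //; lia.
- have -> : m * m = \sum_(x < m) \sum_(y < m) 1.
    by rewrite !sum_nat_const card_ord muln1.
  rewrite /crossings; apply: leq_sum => x _; apply: leq_sum => y _.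
  by rewrite /winding; lia.
Qed.

End Ranks.

(** * Swapping sequences *)

Section Walks.
Variables (n : nat) (G : rel 'I_n).
Implicit Types (w : seq 'I_n) (f g ft : placement n) (ws : seq (seq 'I_n)).

Definition at_ w (x : 'I_(size w)) : 'I_n := tnth (in_tuple w) x.
Definition word f w : 'I_(size w) -> nat := fun x => f (at_ w x).

(** In a simple graph a single vertex is not closed, while a walk of two vertices is closed by its
    own edge; its seam swap exchanges the same two places. *)
Definition closed_walk w : bool :=
  if w is v :: s then G (last v s) v else false.

Definition feasible f ft w k : Prop :=
  exists (q : 'I_(size w) -> int) (r : 'I_(size w) -> 'I_(size w)),
  [/\ injective r /\ (\sum_z q z = 0)%R, forall x, word ft w (r x) = word f w x,
      closed_walk w \/ (forall x, q x = 0%R) & crossings _ q r <= k].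

(* Adjacent placements differ, so tokens of equal colour never cross. *)
Definition order_feasible f ft w k : Prop :=
  exists (q : 'I_(size w) -> int) (r : 'I_(size w) -> 'I_(size w)),
  [/\ injective r /\ (\sum_z q z = 0)%R, forall x, word ft w (r x) = word f w x,
      closed_walk w \/ (forall x, q x = 0%R), crossings _ q r <= k &
      order_preserving _ (word f w) q r].

Definition walk_edge w u v : Prop :=
  exists wrap x y, [/\ cyclic_edge (size w) wrap x y, wrap -> closed_walk w &
    (u = at_ w x /\ v = at_ w y) \/ (u = at_ w y /\ v = at_ w x)].

Record walk_decomposition ws : Prop := WalkDecomposition {
  wd_uniq : uniq ws;
  wd_uniq_walk w : w \in ws -> uniq w;
  wd_sorted w : w \in ws -> sorted G w;
  wd_disjoint w w' v : w \in ws -> w' \in ws -> v \in w -> v \in w' -> w = w';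
  wd_cover v : exists2 w, w \in ws & v \in w;
  wd_edge u v : G u v -> exists2 w, w \in ws & walk_edge w u v }.

(** Also covers the exchange of equal colours, which changes nothing and is no step of a swapping
    sequence. *)
Definition swapf u v f : placement n := [ffun z => f (tperm u v z)].

Lemma swapfC u v f : swapf u v f = swapf v u f.
Proof. by rewrite /swapf tpermC. Qed.

Lemma adjacentP f f' : adjacent_placements G f f' ->
  exists u v, [/\ G u v, f u != f v & f' = swapf u v f].
Proof.
case/andP => ne /existsP[u] /existsP[v] /and4P[guv /eqP fu /eqP fv /forallP fw].
have E : f' = swapf u v f.
  apply/ffunP => z; rewrite ffunE; case: tpermP => [->|->|/eqP hu /eqP hv] //.
  by have := fw z; rewrite hu hv => /eqP.
exists u, v; split=> //; apply: contra ne => /eqP fuv.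
rewrite E; apply/eqP/ffunP => z; rewrite ffunE.
by case: tpermP => [->|->|].
Qed.

Lemma swapf_adjacent u v f : G u v -> f u != f v -> adjacent_placements G f (swapf u v f).
Proof.
move=> guv ne; apply/andP; split.
  by apply: contra ne => /eqP {1}->; rewrite ffunE tpermL.
apply/existsP; exists u; apply/existsP; exists v.
rewrite guv !ffunE tpermL tpermR !eqxx /=; apply/forallP => z.
by apply/implyP => /andP[hu hv]; rewrite ffunE tpermD // eq_sym.
Qed.

Lemma swapf_same u v f : f u = f v -> swapf u v f = f.
Proof. by move=> E; apply/ffunP => z; rewrite ffunE; case: tpermP => [->|->|]. Qed.

Lemma token_swapf c u v f : token_placement c f -> token_placement c (swapf u v f).
Proof.
case/andP => /forallP h1 /allP h2; apply/andP; split.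
  by apply/forallP => z; rewrite ffunE.
apply/allP => k hk; have /existsP[z hz] := h2 k hk.
by apply/existsP; exists (tperm u v z); rewrite ffunE tpermK.
Qed.

Lemma token_path c f s : token_placement c f -> path (adjacent_placements G) f s ->
  all (@token_placement c n) (f :: s).
Proof.
elim: s f => [|f' s IH] f tf /=; first by rewrite tf.
case/andP => /adjacentP[u [v [_ _ E]]] hs; rewrite tf /=.
by apply: IH hs; rewrite E; apply: token_swapf.
Qed.

Lemma at_inj w : uniq w -> injective (at_ w).
Proof.
move=> uw x y; rewrite /at_ !(tnth_nth (at_ w x)) /= => E; apply: val_inj => /=.
by apply/eqP; rewrite -(nth_uniq (at_ w x) (ltn_ord x) (ltn_ord y) uw) E.
Qed.

Lemma mem_at w x : at_ w x \in w.
Proof. exact: mem_tnth. Qed.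

Lemma at_surj w v : v \in w -> exists x, v = at_ w x.
Proof. by move=> /(tnthP (in_tuple w))[x ->]; exists x. Qed.

Lemma word_swapf w x y f z : uniq w ->
  word (swapf (at_ w x) (at_ w y) f) w z = word f w (tperm x y z).
Proof.
move=> uw; rewrite /word ffunE; congr (f _).
have ai := at_inj w uw.
case: (tpermP x y) => [->|->|hx hy]; rewrite ?tpermL ?tpermR //.
by rewrite tpermD //; apply/eqP => /ai /esym.
Qed.

Lemma closed_walk_last w (x y : 'I_(size w)) : closed_walk w -> x.+1 = size w -> y = 0 :> nat ->
  G (at_ w x) (at_ w y).
Proof.
case: w x y => [|v s] x y; first by case: x.
move=> /= cl hx hy; rewrite /at_ !(tnth_nth v) /= hy /=.
by case: hx => ->; rewrite -/(nth v (v :: s) (size s)) nth_last.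
Qed.

Lemma walk_edge_adj w wrap (x y : 'I_(size w)) : sorted G w -> cyclic_edge (size w) wrap x y ->
  (wrap -> closed_walk w) -> G (at_ w x) (at_ w y).
Proof.
move=> sw; case: wrap => /=.
  by case/andP=> /andP[/eqP hx /eqP hy] _ /(_ isT) cl; apply: closed_walk_last.
move=> /eqP hy _; rewrite /at_ !(tnth_nth (at_ w x)) /= hy.
by have /sortedP := sw; apply; rewrite -hy.
Qed.

(** Prepending the swap changes the winding of the swapped pair only. These two tokens have
    different colours, so pairs of equal colour keep winding 0. *)
Lemma order_feasible_swap f ft w wrap (x y : 'I_(size w)) k : uniq w ->
  cyclic_edge (size w) wrap x y -> (wrap -> closed_walk w) ->
  f (at_ w x) != f (at_ w y) ->
  order_feasible (swapf (at_ w x) (at_ w y) f) ft w k -> order_feasible f ft w k.+2.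
Proof.
move=> uw ed cl ne [q [r [[ir sq] hr hc hk op]]].
exists (swap_q _ wrap x y q), (swap_r _ x y r); split.
- by split; [apply: swap_r_inj | rewrite swap_q_sum].
- by move=> z; rewrite /swap_r hr word_swapf // tpermK.
- case: hc => [|q0]; first by left.
  case: (wrap) cl => [/(_ isT)|] cl; [by left|right=> z].
  by rewrite /swap_q q0.
- by have := crossings_swapE _ _ _ _ q r ir ed; lia.
- move=> z1 z2 E; rewrite -(tpermK x y z1) -(tpermK x y z2) winding_swap // op; last first.
    by rewrite !word_swapf // !tpermK.
  have w12 p1 p2 : (tperm x y z1 == p1) && (tperm x y z2 == p2) ->
      word f w (tperm x y p1) = word f w (tperm x y p2).
    by case/andP=> /eqP <- /eqP <-; rewrite !tpermK.
  have /negbTE -> : ~~ ((tperm x y z1 == x) && (tperm x y z2 == y)).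
    by apply: contra ne => /w12; rewrite tpermL tpermR /word => ->.
  have /negbTE -> : ~~ ((tperm x y z1 == y) && (tperm x y z2 == x)).
    by apply: contra ne => /w12; rewrite tpermL tpermR /word => ->.
  by [].
Qed.

Lemma order_feasible_refl f w : uniq w -> order_feasible f f w 0.
Proof.
move=> uw; exists (fun=> 0%R), id; split=> //.
- by split=> //; rewrite big1.
- by right.
- by rewrite leqn0 /crossings big1 // => x _; rewrite big1 // => y _; rewrite /winding; lia.
- by move=> x y _; rewrite /winding; lia.
Qed.

Lemma order_feasible_ext f g ft w k : {in w, f =1 g} ->
  order_feasible f ft w k -> order_feasible g ft w k.
Proof.
move=> fg [q [r [h1 h2 h3 h4 h5]]].
have E x : word g w x = word f w x by rewrite /word fg // mem_at.
exists q, r; split=> //; first by move=> x; rewrite E.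
by move=> x y; rewrite !E; apply: h5.
Qed.

Lemma feasible_ext f g ft w k : {in w, f =1 g} ->
  feasible f ft w k -> feasible g ft w k.
Proof.
move=> fg [q [r [h1 h2 h3 h4]]]; exists q, r; split=> // x.
by rewrite h2 /word fg // mem_at.
Qed.

(** The lower bound: going backwards from the trivial configuration at [ft], each swap adds at most
    2 to the cost of the one walk that carries its edge. *)
Lemma swap_sequence_order_feasible ws f ft s : walk_decomposition ws ->
  path (adjacent_placements G) f s -> last f s = ft ->
  exists2 k : seq 'I_n -> nat, forall w, w \in ws -> order_feasible f ft w (k w) &
    \sum_(w <- ws) k w <= (size s).*2.
Proof.
move=> wd; elim: s f => [|f' s IH] f /=.
  move=> _ <-; exists (fun=> 0); last by rewrite big1.
  by move=> w /(wd_uniq_walk _ wd); apply: order_feasible_refl.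
case/andP=> /adjacentP[u [v [guv ne E]]] hs hl.
have [k hk sk] := IH _ hs hl.
have [w0 w0s [wrap [x [y [ed cl uv]]]]] := wd_edge _ wd _ _ guv.
exists (fun w => k w + (w == w0).*2); last first.
  have cw : \sum_(w <- ws) (w == w0) = count_mem w0 ws.
    by rewrite -sum1_count [RHS]big_mkcond; apply: eq_bigr => w _ /=; case: (w == w0).
  rewrite big_split /= doubleS -addn2 leq_add //.
  under eq_bigr => w _ do rewrite -mul2n.
  by rewrite -big_distrr /= cw count_uniq_mem ?(wd_uniq _ wd) //; case: (_ \in _).
have f'E : f' = swapf (at_ w0 x) (at_ w0 y) f.
  by case: uv => -[-> ->] in E *; rewrite // swapfC.
have ne' : f (at_ w0 x) != f (at_ w0 y).
  by case: uv => -[-> ->] in ne *; rewrite // eq_sym.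
move=> w ww; case: eqVneq => [->|nw].
  rewrite addn2; apply: order_feasible_swap ed cl ne' _; first exact: (wd_uniq_walk _ wd).
  by rewrite -f'E; apply: hk.
rewrite addn0; apply: order_feasible_ext (hk _ ww) => z zw.
rewrite f'E ffunE tpermD //.
- apply: contraNneq nw => zx; apply/eqP.
  by apply: (wd_disjoint _ wd _ _ z) => //; rewrite -zx mem_at.
- apply: contraNneq nw => zx; apply/eqP.
  by apply: (wd_disjoint _ wd _ _ z) => //; rewrite -zx mem_at.
Qed.

Definition patch w ft f : placement n := [ffun v => if v \in w then ft v else f v].

(** The upper bound, by descent: a negative winding on an edge of the walk is swapped away, saving
    2; when there is none, the configuration is the identity. If the two colours are equal, the
    placement does not change and the swap is dropped from the sequence. *)
Lemma feasible_path w ft k f : uniq w -> sorted G w -> feasible f ft w k ->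
  exists s, [/\ path (adjacent_placements G) f s, (size s).*2 <= k &
    last f s = patch w ft f].
Proof.
move=> uw sw; elim/ltn_ind: k f => k IH f [q [r [[ir sq] hr hc hk]]].
pose desc (t : bool * ('I_(size w) * 'I_(size w))) :=
  [&& cyclic_edge _ t.1 t.2.1 t.2.2, t.1 ==> closed_walk w &
      (winding _ q r t.2.1 t.2.2 < 0)%R].
case: (pickP desc) => [[wrap [x y]] /and3P[/= ed /implyP cl wn]|nodesc].
  have cE := crossings_swapE _ _ _ _ q r ir ed.
  have k2 : 2 <= k by lia.
  have fs : feasible (swapf (at_ w x) (at_ w y) f) ft w (k - 2).
    exists (swap_q _ wrap x y q), (swap_r _ x y r); split.
    - by split; [apply: swap_r_inj | rewrite swap_q_sum].
    - by move=> z; rewrite /swap_r hr word_swapf.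
    - case: hc => [|q0]; first by left.
      case: (wrap) cl => [/(_ isT)|] cl; [by left|right=> z].
      by rewrite /swap_q q0.
    - lia.
  have [|s [hs1 hs2 hs3]] := IH (k - 2) _ _ fs; first lia.
  have pE : patch w ft (swapf (at_ w x) (at_ w y) f) = patch w ft f.
    apply/ffunP => z; rewrite !ffunE; case: ifPn => // zw; rewrite tpermD //.
    - by apply: contraNneq zw => <-; apply: mem_at.
    - by apply: contraNneq zw => <-; apply: mem_at.
  rewrite pE in hs3.
  have [E|ne] := eqVneq (f (at_ w x)) (f (at_ w y)).
    rewrite swapf_same // in hs1 hs3; exists s; split=> //; lia.
  exists (swapf (at_ w x) (at_ w y) f :: s); split=> //=; last lia.
  by rewrite hs1 andbT swapf_adjacent // (walk_edge_adj w wrap).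
have up x y : cyclic_edge (size w) false x y -> (0 <= winding _ q r x y)%R.
  move=> ed; rewrite leNgt; apply/negP => h.
  by have /negP[] := negbT (nodesc (false, (x, y))); apply/and3P.
have q0 : forall x, q x = 0%R.
  apply: (no_descent_q _ q r ir sq up); case: hc => [cl|]; [right|by left].
  move=> x y ed; rewrite leNgt; apply/negP => h.
  by have /negP[] := negbT (nodesc (true, (x, y))); apply/and3P; split=> //; apply/implyP.
have rid := no_descent_id _ q r ir q0 up.
exists [::]; split=> //=; apply/ffunP => v; rewrite ffunE.
by case: ifP => // /at_surj[x ->]; have := hr x; rewrite rid /word.
Qed.

Lemma feasible_paths ws ft (k : seq 'I_n -> nat) f : uniq ws ->
  (forall w w' v, w \in ws -> w' \in ws -> v \in w -> v \in w' -> w = w') ->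
  (forall w, w \in ws -> [/\ uniq w, sorted G w & feasible f ft w (k w)]) ->
  exists s, [/\ path (adjacent_placements G) f s, (size s).*2 <= \sum_(w <- ws) k w &
    forall v, last f s v = if has (fun w => v \in w) ws then ft v else f v].
Proof.
elim: ws f => [|w ws IH] f; first by exists [::]; split.
case/andP=> wnotin uws dis hw.
have [uw sw fw] := hw w (mem_head _ _).
have [s1 [p1 l1 e1]] := feasible_path _ _ _ _ uw sw fw.
have [||s2 [p2 l2 e2]] := IH (patch w ft f) uws.
- by move=> w1 w2 v h1 h2; apply: dis; rewrite inE ?h1 ?h2 orbT.
- move=> w1 h1; have [|u1 o1 f1] := hw w1; first by rewrite inE h1 orbT.
  split=> //; apply: feasible_ext f1 => z zw1; rewrite ffunE ifN //.
  apply: contra wnotin => zw; rewrite (dis w w1 z) ?inE ?eqxx ?h1 ?orbT //.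
exists (s1 ++ s2); split.
- by rewrite cat_path p1 e1.
- by rewrite size_cat doubleD big_cons leq_add.
- by move=> v; rewrite last_cat e1 e2 ffunE /=; case: (v \in w); case: has.
Qed.

Lemma feasible_OPT_le c ws f ft (k : seq 'I_n -> nat) l :
  walk_decomposition ws -> token_placement c f ->
  (forall w, w \in ws -> feasible f ft w (k w)) ->
  \sum_(w <- ws) k w <= l.*2 -> OPT_le c G f ft l.
Proof.
move=> wd tf hw hl.
have [||s [p1 l1 e1]] := feasible_paths ws ft k f (wd_uniq _ wd).
- exact: (wd_disjoint _ wd).
- move=> w ww; split; [exact: (wd_uniq_walk _ wd)|exact: (wd_sorted _ wd)|exact: hw].
exists s; split=> //.
- apply/ffunP => v; rewrite e1; have [w ww vw] := wd_cover _ wd v.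
  by rewrite (introT hasP) //; exists w.
- exact: token_path.
- by rewrite -leq_double; apply: leq_trans l1 hl.
Qed.

End Walks.

(** * Configurations given by fluxes *)

Section Encoding.
Variable m : nat.
Implicit Types (a b : 'I_m -> nat) (u : nat -> nat).

(* [o] is an offset that keeps the windings and the fluxes natural numbers:
   [Q = q + o] and [u = flux + o].  As [mult a x > 0], the subtraction is exact. *)
Definition shifted_rank a u o x : nat :=
  rank m a x + u (a x) + o * mult m a x - o.

(** The rank formula read as division with remainder: the rank at the target is below the
    multiplicity, so turns and target rank are quotient and remainder. *)
Definition encodes a b u o (Q : 'I_m -> nat) (R : 'I_m -> 'I_m) : Prop :=
  forall x, [/\ Q x = shifted_rank a u o x %/ mult m a x, b (R x) = a x &
    rank m b (R x) = shifted_rank a u o x %% mult m a x].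

(** The positive and negative parts of q = Q - o are summed apart. When they agree, one part being 0
    makes q vanish everywhere. *)
Definition balanced (closed : bool) o (Q : 'I_m -> nat) : bool :=
  (\sum_x (Q x - o) == \sum_x (o - Q x)) && (closed || (\sum_x (Q x - o) == 0)).

Definition crossing_number (Q : 'I_m -> nat) (R : 'I_m -> 'I_m) : nat :=
  \sum_(x < m) \sum_(y < m)
    ((Q y + (y < x) - (Q x + (R y < R x))) + (Q x + (R y < R x) - (Q y + (y < x)))).

Lemma mult_gt0 a x : 0 < mult m a x.
Proof. exact: leq_ltn_trans (leq0n _) (rank_lt_mult m a x). Qed.

(** Distinct positions of one colour have shifted ranks that differ by less than the class size,
    hence distinct remainders. *)
Lemma encodes_inj a b u o Q R : encodes a b u o Q R -> injective R.
Proof.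
move=> enc x y E.
have [_ bx rx] := enc x; have [_ by_ ry] := enc y.
have axy : a x = a y by rewrite -bx -by_ E.
apply: (rank_inj _ a) => //; move: rx; rewrite E ry /shifted_rank axy.
have k0 := mult_gt0 a y; have lx := rank_lt_mult m a x; have ly := rank_lt_mult m a y.
have mE : mult m a x = mult m a y by rewrite /mult axy.
rewrite mE in lx *; set k := mult m a y in k0 lx ly *.
have sh z : rank m a z + u (a y) + o * k - o = rank m a z + (u (a y) + (o * k - o)) by nia.
by rewrite !sh => /eqP; rewrite eqn_modDr !modn_small // => /eqP.
Qed.

Lemma crossing_numberE Q R o :
  crossing_number Q R = crossings m (fun x => Posz (Q x) - Posz o)%R R.
Proof.
by rewrite /crossing_number /crossings; apply: eq_bigr => x _; apply: eq_bigr => y _;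
  rewrite /winding; lia.
Qed.

Lemma sum_int (F : 'I_m -> nat) : (\sum_x Posz (F x) = Posz (\sum_x F x))%R.
Proof. by rewrite (big_morph Posz PoszD (erefl 0%R)). Qed.

Lemma balanced_sum closed o Q :
  balanced closed o Q = ((\sum_x (Posz (Q x) - Posz o) == 0)%R) &&
    (closed || [forall x, Q x == o]).
Proof.
rewrite /balanced.
have -> : (\sum_x (Posz (Q x) - Posz o) = Posz (\sum_x (Q x - o)) - Posz (\sum_x (o - Q x)))%R.
  by rewrite -!sum_int -sumrB; apply: eq_bigr => x _; lia.
rewrite subr_eq0 eqz_nat; case: eqP => //= E; congr (_ || _).
apply/idP/forallP => [/eqP h x|h].
- have /eqP := h; rewrite sum_nat_eq0 => /forallP /(_ x) /= h1.
  have /eqP := esym E; rewrite h sum_nat_eq0 => /forallP /(_ x) /= h2; lia.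
- by rewrite big1 // => x _; rewrite (eqP (h x)) subnn.
Qed.

End Encoding.

Lemma encodes_feasible n (G : rel 'I_n) (f ft : placement n) w u o Q R :
  encodes _ (word n f w) (word n ft w) u o Q R ->
  balanced _ (closed_walk n G w) o Q ->
  feasible n G f ft w (crossing_number _ Q R).
Proof.
move=> enc; rewrite balanced_sum => /andP[/eqP sq cl].
exists (fun x => Posz (Q x) - Posz o)%R, R; split.
- by split=> //; apply: encodes_inj enc.
- by move=> x; case: (enc x).
- by case/orP: cl => [|/forallP h]; [left|right=> x; rewrite (eqP (h x)) subrr].
- by rewrite (crossing_numberE _ _ _ o).
Qed.

(** Completeness of the search space: shifted fluxes between 0 and 4n, the last one determined by
    the others, miss no order-feasible cost. *)
Lemma order_feasible_encodes n (G : rel 'I_n) (f ft : placement n) w c k :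
  uniq w -> (forall v, 0 < f v <= c) -> 0 < c -> order_feasible n G f ft w k ->
  exists (u : nat -> nat) Q R,
  [/\ encodes _ (word n f w) (word n ft w) u n.*2 Q R,
      balanced _ (closed_walk n G w) n.*2 Q,
      crossing_number _ Q R <= k,
      forall j, u j <= n.*2.*2 &
      u c = c * n.*2 - \sum_(1 <= j < c) u j].
Proof.
move=> uw fc c0 [q0 [r0 [[ir0 sq0] hr0 hc0 hk0 op0]]].
have mn : size w <= n by rewrite -(card_uniqP uw) -[leqRHS](card_ord n) max_card.
(* Above cost m^2 the configuration without turns is cheaper and takes over; this is what bounds the
   fluxes. *)
have {q0 r0 ir0 sq0 hr0 hc0 hk0 op0} [q [r [[ir sq] hr hc [hk hm] op]]] :
  exists (q : 'I_(size w) -> int) (r : 'I_(size w) -> 'I_(size w)),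
  [/\ injective r /\ (\sum_z q z = 0)%R, forall x, word n ft w (r x) = word n f w x,
      closed_walk n G w \/ (forall x, q x = 0%R),
      crossings _ q r <= k /\ crossings _ q r <= size w * size w &
      order_preserving _ (word n f w) q r].
  case: (leqP (crossings _ q0 r0) (size w * size w)) => h; first by exists q0, r0.
  have [r [h1 h2 h3 h4]] := order_preserving_base _ _ _ r0 ir0 hr0.
  exists (fun=> 0%R), r; split=> //; first by split=> //; rewrite big1.
  - by right.
  - by split=> //; apply: leq_trans h4 _; apply: leq_trans (ltnW h) hk0.
pose a := word n f w; pose ph := flux _ a q.
have phb j : (- Posz n.*2 <= ph j <= Posz n.*2)%R.
  have := flux_bound _ a q r j sq; rewrite -/(ph j).
  case: (posnP (size w)) => [m0 _|m_gt0 h].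
    have -> : ph j = 0%R by rewrite /ph /flux big1 // => x; move: (ltn_ord x); rewrite [X in _ < X]m0.
    lia.
  have : `|ph j| <= 2 * size w .
    rewrite -(leq_pmul2l m_gt0) mulnCA mul2n -addnn.
    by apply: leq_trans h _; rewrite leq_add2r.
  lia.
pose u j := `|(ph j + Posz n.*2)%R|%N.
have uE j : (Posz (u j) = ph j + Posz n.*2)%R by have := phb j; rewrite /u; lia.
pose Q x := `|(q x + Posz n.*2)%R|%N.
have form x := rank_formula _ a (word n ft w) q r x ir hr op.
have QE x : (Posz (Q x) = q x + Posz n.*2)%R.
  have := form x; rewrite -/(ph _) => E.
  have h1 := rank_lt_mult _ (word n ft w) (r x).
  have mE : mult _ (word n ft w) (r x) = mult _ a x.
    rewrite /mult (reindex_inj ir); apply: eq_bigr => z _; by rewrite !hr.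
  rewrite mE in h1; have h2 := phb (a x); rewrite /Q; have h3 := mult_gt0 _ a x.
  (* The target rank is below the multiplicity, so a flux of at least -2n cannot come with more than
     2n turns backwards. *)
  suff : (0 <= q x + Posz n.*2)%R by lia.
  nia.
exists u, Q, r; split.
- move=> x; have h1 := rank_lt_mult _ (word n ft w) (r x).
  have mE : mult _ (word n ft w) (r x) = mult _ a x.
    rewrite /mult (reindex_inj ir); apply: eq_bigr => z _; by rewrite !hr.
  rewrite mE in h1.
  have E : shifted_rank _ a u n.*2 x = Q x * mult _ a x + rank _ (word n ft w) (r x).
    have h3 := mult_gt0 _ a x; have h4 := form x; have h5 := uE (a x); have h6 := QE x.
    rewrite -/(ph _) in h4; rewrite /shifted_rank.
    have : n.*2 <= n.*2 * mult _ a x by nia.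
    nia.
  rewrite -/a E divnMDl ?mult_gt0 // divn_small // addn0 modnMDl modn_small //.
- rewrite balanced_sum; apply/andP; split.
    by apply/eqP; rewrite -[RHS]sq; apply: eq_bigr => x _; rewrite QE addrK.
  case: hc => [->//|q0]; apply/orP; right; apply/forallP => x.
  by have := QE x; rewrite q0; lia.
- rewrite (crossing_numberE _ _ _ n.*2); move: hk; rewrite /crossings => hk.
  apply: leq_trans hk; apply: eq_leq; apply: eq_bigr => x _; apply: eq_bigr => y _.
  by rewrite /winding !QE !addrK.
- by move=> j; have := uE j; have := phb j; lia.
(* Every position has exactly one colour between 1 and [c], so these fluxes add up to the sum of
   [q], which is 0. *)
- have tot : \sum_(1 <= j < c.+1) u j = c * n.*2.
    apply/eqP; rewrite -eqz_nat.
    have -> : (Posz (\sum_(1 <= j < c.+1) u j) = \sum_(1 <= j < c.+1) (ph j + Posz n.*2))%R.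
      by rewrite (big_morph Posz PoszD (erefl 0%R)); apply: eq_bigr => j _; rewrite uE.
    rewrite big_split /= sumr_const_nat subSS subn0.
    have -> : (\sum_(1 <= j < c.+1) ph j = 0)%R.
      rewrite -[RHS]sq /ph /flux (exchange_big_dep xpredT) //=; apply: eq_bigr => x _.
      under eq_bigl => j do rewrite eq_sym.
      by rewrite big_nat1_eq ltnS /a /word fc.
    by rewrite add0r -mulr_natl natz PoszM.
  by rewrite -tot big_nat_recr //= addKn.
Qed.

(** * The program *)

Lemma get_set s a i x a' i' :
  set_cell s a i x a' i' = if (a' == a) && (i' == i) then x else s a' i'.
Proof. by rewrite /set_cell; case: eqP => // ->; case: eqP. Qed.

Fixpoint mods (c : com) : seq nat :=
  match c with
  | Skip => [::]
  | Asg a _ _ => [:: a]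
  | Seq c1 c2 | If _ c1 c2 => mods c1 ++ mods c2
  | Loop _ _ a _ b => a :: mods b
  end.

Lemma set_cell_other s a i x a' : a' != a -> set_cell s a i x a' = s a'.
Proof. by rewrite /set_cell => /negbTE ->. Qed.

Lemma notin_sub (L1 L2 : seq nat) a :
  all (fun x => x \in L2) L1 -> a \notin L2 -> a \notin L1.
Proof. by move=> /allP sub; apply: contra; apply: sub. Qed.

(** * Frame and invariant rules *)

Section Rules.
Variable inp : seq nat.

Lemma sem_frame c s a : a \notin mods c -> sem inp c s a = s a.
Proof.
elim: c s => [|a' e1 e2|c1 IH1 c2 IH2|e c1 IH1 c2 IH2|k1 k2 a' i b IH] s //=.
- by rewrite inE; apply: set_cell_other.
- by rewrite mem_cat negb_or => /andP[h1 h2]; rewrite IH2 ?IH1.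
- by rewrite mem_cat negb_or => /andP[h1 h2]; case: ifP; rewrite ?IH2 ?IH1.
- rewrite inE negb_or => /andP[h1 h2]; elim: (iota _ _) s => //= t r IHr s.
  by rewrite IHr IH // set_cell_other.
Qed.

Lemma sem_frame_sub (L : seq nat) c s a :
  all (fun x => x \in L) (mods c) -> a \notin L -> sem inp c s a = s a.
Proof. by move=> sub aL; apply: sem_frame; apply: notin_sub aL. Qed.

(** The invariant comes with a frame: in every round, the arrays that the loop never assigns still
    have their initial contents. *)
Lemma loop_rule (I : nat -> store -> Prop) k1 k2 a i b s :
  I 0 s ->
  (forall t s', t < bound inp k1 k2 ->
     (forall a', a' \notin a :: mods b -> s' a' = s a') -> I t s' ->
     I t.+1 (sem inp b (set_cell s' a i t))) ->
  I (bound inp k1 k2) (sem inp (Loop k1 k2 a i b) s).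
Proof.
move=> I0 IS; set N := bound _ _ _.
suff H t : t <= N -> let s' := foldl (fun s t => sem inp b (set_cell s a i t)) s (iota 0 t) in
    (forall a', a' \notin a :: mods b -> s' a' = s a') /\ I t s'.
  by have [] := H N (leqnn N).
elim: t => [|t IH] tN; first by [].
have [fr It] := IH (ltnW tN).
have -> : iota 0 t.+1 = iota 0 t ++ [:: t] by rewrite -addn1 iotaD.
rewrite foldl_cat; split; last exact: IS.
move=> a' ha'; rewrite -(fr a' ha'); move: ha'; rewrite inE negb_or => /andP[h1 h2].
by rewrite /= sem_frame // set_cell_other.
Qed.

Lemma sum_loop_rule (F : nat -> nat) k1 k2 a i b s c j :
  (forall t s', t < bound inp k1 k2 ->
     (forall a', a' \notin a :: mods b -> s' a' = s a') ->
     sem inp b (set_cell s' a i t) c j = s' c j + F t) ->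
  sem inp (Loop k1 k2 a i b) s c j = s c j + \sum_(t < bound inp k1 k2) F t.
Proof.
move=> H; apply: (loop_rule (fun t s' => s' c j = s c j + \sum_(z < t) F z)).
  by rewrite big_ord0 addn0.
by move=> t s' tN fr E; rewrite H // E big_ord_recr addnA.
Qed.

End Rules.

(** Loop lengths depend on [n] alone, so a loop over the [m] positions of a walk runs to [n] behind
    a guard. *)
Lemma sum_guard m n (F : nat -> nat) : m <= n ->
  \sum_(t < n) (if t < m then F t else 0) = \sum_(t < m) F t.
Proof. by move=> mn; rewrite [RHS](big_ord_widen n F mn) [RHS]big_mkcond. Qed.

(* The walk being traced is WALK[LO], ..., WALK[HI - 1]; the adjacency row of [u]
   starts at input entry ROW[u].  CA, CB are the initial and target colours along
   the walk, KA the multiplicity of the colour, and RA, RB the rank of a position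
   within its colour. *)
Definition ROW := 2. Definition VIS := 3. Definition WALK := 4. Definition LO := 5.
Definition HI := 6. Definition FND := 7. Definition NXT := 8. Definition CA := 9.
Definition CB := 10. Definition KA := 11. Definition RA := 12. Definition RB := 13.
Definition PHI := 14. Definition WIND := 15. Definition DEST := 16. Definition VALID := 17.
Definition POS_SUM := 18. Definition NEG_SUM := 19. Definition CROSS := 20. Definition BEST := 21.
Definition TOT := 22. Definition CYC := 23. Definition IDX := 24. Definition QUO := 25.
Definition START := 26. Definition POSX := 27. Definition POSY := 28. Definition STEP := 29.
Definition CUR := 30. Definition LEN := 31.

Notation Var a := (Rd a (Cst 0)).
Notation Put a e := (Asg a (Cst 0) e).
Notation NVERT := (Inp (Cst 0)).
Infix ";;" := Seq (at level 81, right associativity).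

Definition eqE a b := Sub (Cst 1) (Add (Sub a b) (Sub b a)).
Definition ltE a b := Sub (Cst 1) (Sub (Cst 1) (Sub b a)).
Definition andE a b := Sub (Add a b) (Cst 1).
Definition distE a b := Add (Sub a b) (Sub b a).
(** [c] is fixed when the program is built, so products with it, and sums over the colours, are
    unrolled into the expression. *)
Fixpoint mulE k e := if k is k'.+1 then Add e (mulE k' e) else Cst 0.
Fixpoint sumE (e : nat -> expr) j := if j is j'.+1 then Add (sumE e j') (e j) else Cst 0.

Lemma eqn_expr a b : 1 - (a - b + (b - a)) = (a == b). Proof. lia. Qed.
Lemma ltn_expr a b : 1 - (1 - (b - a)) = (a < b). Proof. lia. Qed.
Lemma and_expr (p q : bool) : p + q - 1 = p && q. Proof. by case: p q => [] []. Qed.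
Lemma dist_expr a b : (a - b + (b - a) != 0) = (a != b). Proof. lia. Qed.

Lemma eval_mulE inp s k e : eval inp s (mulE k e) = k * eval inp s e.
Proof. by elim: k => //= k ->. Qed.

Lemma eval_sumE inp s G j :
  eval inp s (sumE G j) = \sum_(1 <= i < j.+1) eval inp s (G i).
Proof.
elim: j => [|j IH]; first by rewrite big_geq.
by rewrite big_nat_recr //= -IH.
Qed.

Definition find_next : com :=
  Put FND (Cst 0) ;;
  Loop 1 0 POSY 0
    (If (Rd VIS (Var POSY)) Skip
       (If (Inp (Add (Rd ROW (Var CUR)) (Var POSY)))
          (Put FND (Cst 1) ;; Put NXT (Var POSY)) Skip)).

Definition extend_right : com :=
  Put CUR (Rd WALK (Sub (Var HI) (Cst 1))) ;; find_next ;;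
  If (Var FND)
    (Asg WALK (Var HI) (Var NXT) ;; Asg VIS (Var NXT) (Cst 1) ;;
     Put HI (Add (Var HI) (Cst 1))) Skip.

Definition extend_left : com :=
  Put CUR (Rd WALK (Var LO)) ;; find_next ;;
  If (Var FND)
    (Put LO (Sub (Var LO) (Cst 1)) ;;
     Asg WALK (Var LO) (Var NXT) ;; Asg VIS (Var NXT) (Cst 1)) Skip.

(** Starting at index [n] leaves room for growth to the left. *)
Definition trace_walk : com :=
  Put LO NVERT ;; Put HI (Add NVERT (Cst 1)) ;;
  Asg WALK NVERT (Var START) ;; Asg VIS (Var START) (Cst 1) ;;
  Loop 1 0 STEP 0 extend_right ;; Loop 1 0 STEP 0 extend_left.

Definition copy_colours : com :=
  If (Sub (Var LEN) (Var POSX))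
    (Asg CA (Var POSX) (Inp (Add (Cst 2) (Rd WALK (Add (Var LO) (Var POSX))))) ;;
     Asg CB (Var POSX) (Inp (Add (Add (Cst 2) NVERT) (Rd WALK (Add (Var LO) (Var POSX))))))
    Skip.

Definition rank_step : com :=
  If (Sub (Var LEN) (Var POSY))
    (Asg KA (Var POSX) (Add (Rd KA (Var POSX))
       (eqE (Rd CA (Var POSY)) (Rd CA (Var POSX)))) ;;
     Asg RA (Var POSX) (Add (Rd RA (Var POSX))
       (andE (ltE (Var POSY) (Var POSX)) (eqE (Rd CA (Var POSY)) (Rd CA (Var POSX))))) ;;
     Asg RB (Var POSX) (Add (Rd RB (Var POSX))
       (andE (ltE (Var POSY) (Var POSX)) (eqE (Rd CB (Var POSY)) (Rd CB (Var POSX))))))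
    Skip.

Definition rank_position : com :=
  Asg KA (Var POSX) (Cst 0) ;; Asg RA (Var POSX) (Cst 0) ;; Asg RB (Var POSX) (Cst 0) ;;
  Loop 1 0 POSY 0 rank_step.

Definition tabulate : com :=
  Put LEN (Sub (Var HI) (Var LO)) ;;
  Put CYC (Inp (Add (Rd ROW (Rd WALK (Sub (Var HI) (Cst 1)))) (Rd WALK (Var LO)))) ;;
  Loop 1 0 POSX 0 copy_colours ;; Loop 1 0 POSX 0 rank_position.

Definition add_multiplicity : com :=
  Put IDX (Add (Var IDX) (Rd KA (Var POSX))).

Definition divide_step : com :=
  If (Sub (Rd KA (Var POSX)) (Var IDX)) Skip
    (Put IDX (Sub (Var IDX) (Rd KA (Var POSX))) ;; Put QUO (Add (Var QUO) (Cst 1))).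

(** The search fails when the target placement has too few places of the colour on the walk. *)
Definition search_target : com :=
  If (Sub (Var LEN) (Var POSY))
    (If (distE (Rd CB (Var POSY)) (Rd CA (Var POSX))) Skip
      (If (distE (Rd RB (Var POSY)) (Var IDX)) Skip
        (Put FND (Cst 1) ;; Asg DEST (Var POSX) (Var POSY))))
    Skip.

(** 2n times the multiplicity is added up in one loop, and the quotient is counted by repeated
    subtraction. Shifted fluxes are at most (2c+4)n, so at most (2c+6)n subtractions occur. *)
Definition encode_position c : com :=
  Put IDX (Add (Rd RA (Var POSX)) (Rd PHI (Rd CA (Var POSX)))) ;;
  Loop 2 0 STEP 0 add_multiplicity ;;
  Put IDX (Sub (Var IDX) (Add NVERT NVERT)) ;; Put QUO (Cst 0) ;;
  Loop (c.*2 + 7) 0 STEP 0 divide_step ;;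
  Asg WIND (Var POSX) (Var QUO) ;; Put FND (Cst 0) ;;
  Loop 1 0 POSY 0 search_target ;;
  If (Var FND) Skip (Put VALID (Cst 0)) ;;
  Put POS_SUM (Add (Var POS_SUM) (Sub (Var QUO) (Add NVERT NVERT))) ;;
  Put NEG_SUM (Add (Var NEG_SUM) (Sub (Add NVERT NVERT) (Var QUO))).

Definition encode_all c : com :=
  Put VALID (Cst 1) ;; Put POS_SUM (Cst 0) ;; Put NEG_SUM (Cst 0) ;;
  Loop 1 0 POSX 0 (If (Sub (Var LEN) (Var POSX)) (encode_position c) Skip).

Definition crossing_step : com :=
  If (Sub (Var LEN) (Var POSX))
    (If (Sub (Var LEN) (Var POSY))
      (Put CROSS (Add (Var CROSS)
        (distE (Add (Rd WIND (Var POSY)) (ltE (Var POSY) (Var POSX)))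
               (Add (Rd WIND (Var POSX)) (ltE (Rd DEST (Var POSY)) (Rd DEST (Var POSX)))))))
      Skip) Skip.

Definition count_crossings : com :=
  Put CROSS (Cst 0) ;; Loop 1 0 POSX 0 (Loop 1 0 POSY 0 crossing_step).

Definition update_best : com :=
  If (Var VALID)
    (If (distE (Var POS_SUM) (Var NEG_SUM)) Skip
      (If (Add (Var CYC) (Sub (Cst 1) (Var POS_SUM)))
        (If (Sub (Var BEST) (Var CROSS)) (Put BEST (Var CROSS)) Skip)
        Skip))
    Skip.

Definition evaluate c : com := encode_all c ;; count_crossings ;; update_best.

(* Entry [i] of [PHI] is the flux of colour [i] plus [2n], and optimal fluxes have
   absolute value at most [2n].  The last flux is determined by the others, since
   the fluxes sum to zero; this keeps the loop depth at [c - 1]. *)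
Fixpoint search c j : com :=
  if j is j'.+1 then Loop 4 1 PHI j (search c j')
  else Asg PHI (Cst c) (Sub (mulE c (Add NVERT NVERT)) (sumE (fun i => Rd PHI (Cst i)) c.-1)) ;;
       evaluate c.

(** The initial value 2l+1 stands for infinity: a single walk of this cost exceeds the doubled
    budget 2l. *)
Definition process c : com :=
  trace_walk ;; tabulate ;;
  Put BEST (Add (Add (Inp (Cst 1)) (Inp (Cst 1))) (Cst 1)) ;;
  search c c.-1 ;; Put TOT (Add (Var TOT) (Var BEST)).

Definition init_rows : com :=
  Put IDX (Add (Cst 2) (Add NVERT NVERT)) ;;
  Loop 1 0 POSX 0 (Asg ROW (Var POSX) (Var IDX) ;; Put IDX (Add (Var IDX) NVERT)).

Definition main_program c : com :=
  init_rows ;; Loop 1 0 START 0 (If (Rd VIS (Var START)) Skip (process c)).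

Definition answer : expr :=
  Sub (Cst 1) (Sub (Var TOT) (Add (Inp (Cst 1)) (Inp (Cst 1)))).

Lemma expr_wf_mulE k e : expr_wf e -> expr_wf (mulE k e).
Proof. by move=> h; elim: k => //= k ->; rewrite h. Qed.

Lemma expr_wf_sumE G j : (forall i, expr_wf (G i)) -> expr_wf (sumE G j).
Proof. by move=> h; elim: j => //= j ->; rewrite h. Qed.

Lemma search_wf c j : com_wf (search c j).
Proof.
elim: j => [|j IH]; last by rewrite /= IH.
have h1 := expr_wf_mulE c (Add NVERT NVERT) isT.
have h2 := expr_wf_sumE (fun i => Rd PHI (Cst i)) c.-1 (fun=> isT).
by rewrite /search /com_wf -/com_wf /expr_wf -/expr_wf h1 h2.
Qed.

Lemma main_wf c : com_wf (main_program c).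
Proof. by rewrite /main_program /process /=; rewrite search_wf. Qed.

Lemma depth_search c j : depth (search c j) = j.+2.
Proof. by elim: j => //= j ->. Qed.

(** One loop over start vertices, [c.-1] over fluxes and two inside an evaluation; tracing and
    tabulating nest no deeper. *)
Lemma depth_main c : 0 < c -> depth (main_program c) = c.+2.
Proof. by case: c => // c _; rewrite /= depth_search /= !maxnSS; lia. Qed.

(** * Correctness of the program *)

Arguments sem : simpl never.

Lemma sem_seq inp c1 c2 s : sem inp (c1 ;; c2) s = sem inp c2 (sem inp c1 s).
Proof. by []. Qed.
Lemma sem_asg inp a e1 e2 s :
  sem inp (Asg a e1 e2) s = set_cell s a (eval inp s e1) (eval inp s e2).
Proof. by []. Qed.
Lemma sem_if inp e c1 c2 s :
  sem inp (If e c1 c2) s = if eval inp s e != 0 then sem inp c1 s else sem inp c2 s.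
Proof. by []. Qed.
Lemma sem_skip inp s : sem inp Skip s = s.
Proof. by []. Qed.
Definition semE := (sem_seq, sem_asg, sem_if, sem_skip).

Lemma nth_allpairs (A B C : Type) (x0 : C) (s0 : A) (t0 : B) (h : A -> B -> C) s t i j :
  i < size s -> j < size t ->
  nth x0 [seq h x y | x <- s, y <- t] (i * size t + j) = h (nth s0 s i) (nth t0 t j).
Proof.
elim: s i => // x s IH [|i] hi hj /=; rewrite nth_cat size_map.
  by rewrite mul0n add0n hj (nth_map t0).
by rewrite mulSn -addnA ltnNge leq_addr /= addKn IH.
Qed.

Section Spec.
Variables (n : nat) (G : rel 'I_n) (f0 ft : placement n) (l : nat).
Let inp := encode_instance G f0 ft l.
Notation run := (sem inp).

Lemma inp_n : nth 0 inp 0 = n. Proof. by []. Qed.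
Lemma inp_l : nth 0 inp 1 = l. Proof. by []. Qed.

Lemma inp_f0 (v : 'I_n) : nth 0 inp (2 + v) = f0 v.
Proof.
rewrite /inp /encode_instance /= ?add0n nth_cat size_map size_enum_ord ltn_ord.
by rewrite (nth_map v) ?size_enum_ord // nth_ord_enum.
Qed.

Lemma inp_ft (v : 'I_n) : nth 0 inp (2 + n + v) = ft v.
Proof.
rewrite /inp /encode_instance /= ?add0n nth_cat size_map size_enum_ord ltnNge leq_addr /= addKn.
rewrite nth_cat size_map size_enum_ord ltn_ord.
by rewrite (nth_map v) ?size_enum_ord // nth_ord_enum.
Qed.

Lemma inp_G (u v : 'I_n) : nth 0 inp (2 + (n + n) + u * n + v) = G u v.
Proof.
rewrite /inp /encode_instance /= ?add0n nth_cat size_map size_enum_ord.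
rewrite ltnNge -!addnA leq_addr /= addKn nth_cat size_map size_enum_ord.
rewrite ltnNge leq_addr /= addKn.
have := nth_allpairs _ _ _ 0 u v (fun x y => nat_of_bool (G x y)) (enum 'I_n) (enum 'I_n) u v.
by rewrite !size_enum_ord !nth_ord_enum => ->.
Qed.

Lemma bound1 : bound inp 1 0 = n. Proof. by rewrite /bound inp_n mul1n addn0. Qed.

Definition rows_ok (s : store) := forall u : 'I_n, s ROW u = 2 + (n + n) + u * n.

Lemma init_rowsP s : rows_ok (run init_rows s).
Proof.
rewrite /init_rows !semE; set s1 := set_cell _ _ _ _.
have := loop_rule inp (fun t s' => s' IDX 0 = 2 + (n + n) + t * n /\
  forall u : 'I_n, u < t -> s' ROW u = 2 + (n + n) + u * n) 1 0 POSX 0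
  (Asg ROW (Var POSX) (Var IDX) ;; Put IDX (Add (Var IDX) NVERT)) s1.
rewrite bound1; case=> //.
- by split=> //; rewrite /s1 get_set /= addn0.
- move=> t s' tn fr [h1 h2]; rewrite !semE /= !get_set /=; split.
    by rewrite h1 mulSn -!addnA (addnC (t * n)).
  move=> u ut; rewrite !get_set /=; case: eqP => [->|ne]; first by rewrite h1.
  by rewrite h2 //; lia.
- by move=> _ h u; apply: h.
Qed.

Lemma find_nextP s (u : 'I_n) : rows_ok s -> s CUR 0 = u ->
  let s' := run find_next s in
  (s' FND 0 = 0 /\ forall v : 'I_n, G u v -> s VIS v != 0) \/
  (s' FND 0 = 1 /\ exists v : 'I_n, [/\ s' NXT 0 = v, G u v & s VIS v = 0]).
Proof.
move=> rows cu s'; rewrite /s' /find_next sem_seq; set s1 := run _ s.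
have := loop_rule inp (fun t s' =>
  (s' FND 0 = 0 /\ forall v : 'I_n, v < t -> G u v -> s VIS v != 0) \/
  (s' FND 0 = 1 /\ exists v : 'I_n, [/\ s' NXT 0 = v, G u v & s VIS v = 0]))
  1 0 POSY 0 (If (Rd VIS (Var POSY)) Skip
       (If (Inp (Add (Rd ROW (Var CUR)) (Var POSY)))
          (Put FND (Cst 1) ;; Put NXT (Var POSY)) Skip)) s1.
rewrite bound1; case.
- by left; rewrite /s1 !semE.
- move=> t s2 tn fr IH; rewrite !semE /= !get_set /=.
  have eV : s2 VIS = s VIS by rewrite fr // /s1 !semE set_cell_other.
  have eR : s2 ROW = s ROW by rewrite fr // /s1 !semE set_cell_other.
  have eC : s2 CUR = s CUR by rewrite fr // /s1 !semE set_cell_other.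
  rewrite eV eR eC cu rows -/inp.
  have -> : nth 0 inp (2 + (n + n) + u * n + t) = G u (Ordinal tn).
    by rewrite -(inp_G u (Ordinal tn)).
  have [vz|vnz] := eqVneq (s VIS t) 0;
    case: IH => [[h1 h2]|[h1 [v [h2 h3 h4]]]].
  + rewrite /=.
    case g: (G u (Ordinal tn)) => /=.
      by right; rewrite ?semE /= !get_set /=; split=> //; exists (Ordinal tn).
    left; rewrite ?semE !get_set /= h1; split=> // v; rewrite ltnS leq_eqVlt.
    case/orP=> [/eqP vt|/h2] //.
    by rewrite (_ : v = Ordinal tn) ?g //; apply: val_inj.
  + right; case g: (G u (Ordinal tn)) => /=.
      by rewrite ?semE /= !get_set /=; split=> //; exists (Ordinal tn).
    by rewrite ?semE !get_set /= h1; split=> //; exists v.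
  + left; rewrite /= ?semE !get_set /= h1; split=> // v; rewrite ltnS leq_eqVlt.
    by case/orP=> [/eqP ->|/h2].
  + right; rewrite /= ?semE !get_set /= h1; split=> //; by exists v.
- by move=> [h1 h2]; left; split=> // v; apply: h2.
- by right.
Qed.
End Spec.

(** * Extending a walk by unvisited vertices *)

Section Tracing.
Variables (n : nat) (G : rel 'I_n) (f0 ft : placement n) (l : nat).
Let inp := encode_instance G f0 ft l.
Notation run := (sem inp).

Definition walk_at (s : store) (w : seq 'I_n) : Prop :=
  s HI 0 = s LO 0 + size w /\
  forall x (v : 'I_n), x < size w -> s WALK (s LO 0 + x) = nth v w x.

Record tracing (vis : pred 'I_n) (s : store) (w : seq 'I_n) : Prop := Tracing {
  tr_uniq : uniq w;
  tr_sorted : sorted G w;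
  tr_new v : v \in w -> ~~ vis v;
  tr_vis (v : 'I_n) : (s VIS v != 0) = vis v || (v \in w);
  tr_at : walk_at s w }.

Definition stuck (vis : pred 'I_n) (w : seq 'I_n) u := forall v, G u v -> vis v || (v \in w).

Lemma tracing_frame vis s s' w : s' VIS = s VIS -> s' WALK = s WALK -> s' LO = s LO ->
  s' HI = s HI -> tracing vis s w -> tracing vis s' w.
Proof.
move=> e1 e2 e3 e4 [h1 h2 h3 h4 [h5 h6]]; split=> //; first by move=> v; rewrite e1 h4.
by split; [rewrite e3 e4 | move=> x v xw; rewrite e2 e3; apply: h6].
Qed.

Lemma extend_rightP vis s u p : rows_ok n s -> tracing vis s (u :: p) ->
  let s' := run extend_right s in s' LO = s LO /\
  ((stuck vis (u :: p) (last u p) /\ tracing vis s' (u :: p)) \/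
   exists v, tracing vis s' (u :: rcons p v)).
Proof.
move=> rows tr; have [uw sw nw vw [hi at_w]] := tr.
rewrite /extend_right 2!sem_seq; set s1 := run (Put _ _) s; set s2 := run _ s1.
have e2 a : a \notin [:: CUR; FND; NXT; POSY] -> s2 a = s a.
  rewrite !inE !negb_or => /and4P[h1 h2 h3 h4].
  rewrite /s2 sem_frame; last first.
    by rewrite -[mods _]/[:: FND; POSY; FND; NXT] !inE !negb_or h2 h3 h4.
  by rewrite /s1 sem_asg set_cell_other.
have rows1 : rows_ok n s1 by move=> z; rewrite /s1 sem_asg set_cell_other // rows.
have cu : s1 CUR 0 = last u p.
  rewrite /s1 sem_asg get_set /= hi /= addnS subn1 /= (at_w _ u) //=.
  by rewrite -/(nth u (u :: p) (size p)) nth_last.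
have := find_nextP n G f0 ft l s1 _ rows1 cu; rewrite -/inp -/s2.
have eV : s1 VIS = s VIS by rewrite /s1 sem_asg set_cell_other.
rewrite sem_if /= eV => -[[h1 h2]|[h1 [v [h2 h3 h4]]]]; rewrite h1 /=.
  rewrite sem_skip; split; first exact: e2.
  left; split; first by move=> v /h2; rewrite vw.
  by apply: tracing_frame tr; apply: e2.
rewrite !semE /=; set s3 := set_cell _ _ _ _.
have eL : s3 LO = s LO by rewrite /s3 !set_cell_other // e2.
split=> //; right; exists v.
have vn : ~~ (vis v || (v \in u :: p)) by rewrite -vw h4.
move: (vn); rewrite negb_or => /andP[vn1 vn2].
rewrite -rcons_cons; split.
- by rewrite rcons_uniq vn2.
- by rewrite /= rcons_path; apply/andP.
- by move=> z; rewrite mem_rcons inE => /orP[/eqP -> //|/nw].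
- move=> z; rewrite mem_rcons [in RHS]inE /s3 !get_set /= h2.
  have [->|ne] := eqVneq z v; first by rewrite eqxx orbT.
  by rewrite val_eqE (negbTE ne) e2 // vw.
- split; rewrite eL.
    by rewrite size_rcons /s3 !get_set /= e2 // hi addn1 !addnS.
  move=> x z; rewrite size_rcons ltnS nth_rcons => xs; rewrite /s3 !get_set /=.
  rewrite (e2 HI) // hi (e2 WALK) // eqn_add2l.
  case: eqP => [->|ne]; first by rewrite h2 ltnn ?eqxx.
  have xs' : x < size (u :: p) by rewrite ltn_neqAle xs andbT; apply/eqP.
  by rewrite xs'; apply: at_w.
Qed.

Lemma extend_leftP vis s u p : symmetric G -> rows_ok n s -> 0 < s LO 0 -> tracing vis s (u :: p) ->
  let s' := run extend_left s in
  (s' LO = s LO /\ stuck vis (u :: p) u /\ tracing vis s' (u :: p)) \/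
  (s' LO 0 = (s LO 0).-1 /\ exists v, tracing vis s' [:: v, u & p]).
Proof.
move=> symG rows lo0 tr; have [uw sw nw vw [hi at_w]] := tr.
rewrite /extend_left 2!sem_seq; set s1 := run (Put _ _) s; set s2 := run _ s1.
have e2 a : a \notin [:: CUR; FND; NXT; POSY] -> s2 a = s a.
  rewrite !inE !negb_or => /and4P[h1 h2 h3 h4].
  rewrite /s2 sem_frame; last first.
    by rewrite -[mods _]/[:: FND; POSY; FND; NXT] !inE !negb_or h2 h3 h4.
  by rewrite /s1 sem_asg set_cell_other.
have rows1 : rows_ok n s1 by move=> z; rewrite /s1 sem_asg set_cell_other // rows.
have cu : s1 CUR 0 = u.
  by rewrite /s1 sem_asg get_set /= -[s LO 0]addn0 (at_w _ u).
have := find_nextP n G f0 ft l s1 _ rows1 cu; rewrite -/inp -/s2.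
have eV : s1 VIS = s VIS by rewrite /s1 sem_asg set_cell_other.
rewrite sem_if /= eV => -[[h1 h2]|[h1 [v [h2 h3 h4]]]]; rewrite h1 /=.
  rewrite sem_skip; left; split; first exact: e2.
  split; first by move=> v /h2; rewrite vw.
  by apply: tracing_frame tr; apply: e2.
rewrite !semE /=; set s3 := set_cell _ _ _ _.
have eL : s3 LO 0 = (s LO 0).-1 by rewrite /s3 !get_set /= e2 // subn1.
right; split=> //; exists v.
have vn : ~~ (vis v || (v \in u :: p)) by rewrite -vw h4.
move: (vn); rewrite negb_or => /andP[vn1 vn2].
split.
- by rewrite cons_uniq vn2.
- by rewrite /= symG h3.
- by move=> z; rewrite inE => /orP[/eqP -> //|/nw].
- move=> z; rewrite /s3 !get_set /= h2 [in RHS]inE.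
  have [->|ne] := eqVneq z v; first by rewrite eqxx orbT.
  by rewrite val_eqE (negbTE ne) e2 // vw.
- split; rewrite eL.
    by rewrite /s3 !get_set /= e2 // hi /=; lia.
  move=> x z xs; rewrite /s3 !get_set /= (e2 LO) // (e2 WALK) // subn1.
  case: x xs => [|x] xs; first by rewrite addn0 eqxx h2.
  have -> : ((s LO 0).-1 + x.+1 == (s LO 0).-1) = false by apply/eqP; lia.
  by rewrite -(at_w x z) //; congr (s WALK _); lia.
Qed.

End Tracing.

(** * Maximal walks in graphs of maximum degree 2 *)

Section Closure.
Variables (n : nat) (G : rel 'I_n).

Lemma uniq_size_le (w : seq 'I_n) : uniq w -> size w <= n.
Proof. by move=> uw; rewrite -(card_uniqP uw) -[leqRHS](card_ord n) max_card. Qed.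

Lemma walk_edge_sym w u v : walk_edge n G w u v -> walk_edge n G w v u.
Proof.
move=> [wrap [x [y [h1 h2 h3]]]]; exists wrap, x, y; split=> //.
by case: h3 => -[-> ->]; [right|left].
Qed.

Lemma walk_edge_succ w z i : i.+1 < size w -> walk_edge n G w (nth z w i) (nth z w i.+1).
Proof.
move=> hi; exists false, (Ordinal (ltnW hi)), (Ordinal hi); split=> //=.
by left; rewrite /at_ !(tnth_nth z).
Qed.

(* An inner vertex of the walk has its two neighbours on the walk, and the
   degree bound leaves room for no other. *)
Lemma inner_neighbours w z i v : symmetric G -> max_degree_le G 2 -> uniq w ->
  sorted G w -> i.+2 < size w -> G (nth z w i.+1) v ->
  v = nth z w i \/ v = nth z w i.+2.
Proof.
move=> symG deg uw sw hi gv.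
have [//|ne1] := eqVneq v (nth z w i); [by left|].
have [//|ne2] := eqVneq v (nth z w i.+2); [by right|].
have step j : j.+1 < size w -> G (nth z w j) (nth z w j.+1).
  by move=> hj; have /sortedP := sw; apply.
have ne3 : nth z w i != nth z w i.+2 by rewrite nth_uniq //; lia.
have u3 : uniq [:: v; nth z w i; nth z w i.+2].
  by rewrite /= !inE negb_or ne1 ne2 ne3.
have := deg (nth z w i.+1).
suff : 2 < #|[pred u | G (nth z w i.+1) u]| by lia.
rewrite -[2.+1]/(size [:: v; nth z w i; nth z w i.+2]) -(card_uniqP u3).
apply: subset_leq_card; apply/subsetP => y; rewrite !inE.
case/or3P => /eqP -> //; last by apply: step.
by rewrite symG; apply: step; lia.
Qed.

Lemma walk_edge_inner w z i v : symmetric G -> max_degree_le G 2 -> uniq w ->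
  sorted G w -> i.+2 < size w -> G (nth z w i.+1) v -> walk_edge n G w (nth z w i.+1) v.
Proof.
move=> symG deg uw sw hi gv.
case: (inner_neighbours w z i v) => // ->.
- by apply: walk_edge_sym; apply: walk_edge_succ; apply: ltnW.
- exact: walk_edge_succ.
Qed.

(** A maximal walk is a whole component. The neighbours of an inner vertex are next to it; an edge
    at an end stays on the walk, so it leads to an inner vertex, already treated, or joins the two
    ends and closes the walk. *)
Lemma stuck_walk_edge (vis : pred 'I_n) u p x y :
  simple_graph G -> max_degree_le G 2 ->
  uniq (u :: p) -> sorted G (u :: p) -> (forall v, v \in u :: p -> ~~ vis v) ->
  (forall v v', vis v -> G v v' -> vis v') ->
  stuck n G vis (u :: p) (last u p) -> stuck n G vis (u :: p) u ->
  x \in u :: p -> G x y -> walk_edge n G (u :: p) x y /\ y \in u :: p.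
Proof.
move=> [irr symG] deg uw sw new clo st1 st2 xw gxy.
pose w := u :: p; have lw : size w = (size p).+1 by [].
have inner v v' i : i.+2 < size w -> v = nth u w i.+1 -> G v v' -> walk_edge n G w v v'.
  by move=> hi -> g; apply: walk_edge_inner.
have we_mem v v' : walk_edge n G w v v' -> v' \in w.
  by move=> [wrap [a [b [_ _ []]]]] [_ ->]; apply: mem_at.
suff H : walk_edge n G w x y by split=> //; apply: we_mem H.
have xE : x = nth u w (index x w) by rewrite nth_index.
have ix : index x w < size w by rewrite index_mem.
have xcase : (exists2 i, i.+2 < size w & x = nth u w i.+1) \/ (x = u \/ x = last u p).
  case E : (index x w) xE ix => [|i] xE ix; first by right; left; exact: xE.
  have [h|h] := ltnP i.+2 (size w); first by left; exists i.
  right; right; rewrite xE (_ : i.+1 = size p); last by move: h ix; rewrite lw; lia.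
  by rewrite -/(nth u w (size p)) nth_last.
case: xcase => [[i hi xi]|xend]; first exact: inner hi xi gxy.
(* A previously visited neighbour is impossible: [vis] is closed under adjacency and would contain
   [x]. *)
have yw : y \in w.
  have : vis y || (y \in w) by case: xend gxy => -> g; [apply: st2|apply: st1].
  case/orP => // vy; have := clo _ _ vy; rewrite symG in gxy => /(_ _ gxy).
  by rewrite (negbTE (new _ xw)).
have yE : y = nth u w (index y w) by rewrite nth_index.
have iy : index y w < size w by rewrite index_mem.
have ycase : (exists2 i, i.+2 < size w & y = nth u w i.+1) \/ (y = u \/ y = last u p).
  case E : (index y w) yE iy => [|i] yE iy; first by right; left; exact: yE.
  have [h|h] := ltnP i.+2 (size w); first by left; exists i.
  right; right; rewrite yE (_ : i.+1 = size p); last by move: h iy; rewrite lw; lia.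
  by rewrite -/(nth u w (size p)) nth_last.
case: ycase => [[i hi yi]|yend].
  by apply: walk_edge_sym; apply: inner hi yi _; rewrite symG.
have h0 : 0 < size w by [].
have hl : size p < size w by [].
have at0 : at_ n w (Ordinal h0) = u by rewrite /at_ (tnth_nth u).
have atl : at_ n w (Ordinal hl) = last u p.
  by rewrite /at_ (tnth_nth u) /= -/(nth u w (size p)) nth_last.
have closing : G (last u p) u -> walk_edge n G w (last u p) u.
  move=> g; exists true, (Ordinal hl), (Ordinal h0); split=> //=.
  - rewrite !eqxx /=; apply: contraTneq g => E.
    by rewrite -at0 -atl E irr.
  - by left.
case: xend gxy => -> ; case: yend => -> gxy.
- by rewrite irr in gxy.
- by apply: walk_edge_sym; apply: closing; rewrite symG.
- exact: closing.
- by rewrite irr in gxy.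
Qed.

End Closure.

Section TraceWalk.
Variables (n : nat) (G : rel 'I_n) (f0 ft : placement n) (l : nat).
Let inp := encode_instance G f0 ft l.
Notation run := (sem inp).

Lemma trace_walkP vis s (v0 : 'I_n) : symmetric G -> rows_ok n s -> s START 0 = v0 ->
  (forall v : 'I_n, (s VIS v != 0) = vis v) -> ~~ vis v0 ->
  exists u p, let s' := run trace_walk s in let w := u :: p in
   [/\ tracing n G vis s' w, v0 \in w, stuck n G vis w (last u p) & stuck n G vis w u].
Proof.
move=> symG rows sV sVIS nv0.
rewrite /trace_walk 5!sem_seq 4!sem_asg; set s1 := set_cell _ VIS _ _.
have e1 a : a \notin [:: LO; HI; WALK; VIS] -> s1 a = s a.
  by rewrite !inE !negb_or => /and4P[h1 h2 h3 h4]; rewrite /s1 !set_cell_other.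
have rows1 : rows_ok n s1 by move=> u; rewrite e1 // rows.
have LO1 : s1 LO 0 = n by rewrite /s1 !get_set /=.
have tr1 : tracing n G vis s1 [:: v0].
  split=> //.
  - by move=> v; rewrite inE => /eqP ->.
  - move=> v; rewrite /s1 /= !get_set /= sV inE.
    by rewrite val_eqE; case: (eqVneq v v0) => _; rewrite ?orbT ?orbF ?sVIS.
  - split; first by rewrite LO1 /s1 /= !get_set /= ?inp_n.
    move=> [|//] v _; rewrite LO1 addn0 /s1 /= !get_set /= ?inp_n eqxx.
    by rewrite ?get_set /= ?sV.
set s2 := run (Loop 1 0 STEP 0 extend_right) s1.
have e2 a : a \notin [:: CUR; FND; NXT; POSY; STEP; WALK; VIS; HI] -> s2 a = s1 a.
  by apply: sem_frame_sub.
have [LO2 [u0 [p0 [tr2 v02 st2]]]] : s2 LO 0 = n /\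
    exists u p, [/\ tracing n G vis s2 (u :: p), v0 \in u :: p &
      stuck n G vis (u :: p) (last u p)].
  (* Each round that is not stuck lengthens the walk, which has at most [n] vertices; so [n] rounds
     suffice. *)
  have := loop_rule inp (fun t s' => s' LO 0 = n /\
    exists u p, [/\ tracing n G vis s' (u :: p), v0 \in u :: p &
      size p = t \/ stuck n G vis (u :: p) (last u p)]) 1 0 STEP 0 extend_right s1.
  rewrite bound1 -/s2; case.
  - by split=> //; exists v0, [::]; split=> //; rewrite ?inE //; left.
  - move=> t s' tn fr [LO' [u [p [tr' v0' st']]]].
    set s3 := set_cell s' STEP 0 t.
    have tr3 : tracing n G vis s3 (u :: p).
      by apply: tracing_frame tr'; rewrite /s3 set_cell_other.
    have rows3 : rows_ok n s3 by move=> z; rewrite /s3 set_cell_other // fr.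
    have [eL []] := extend_rightP n G f0 ft l vis s3 u p rows3 tr3; rewrite -/inp in eL *.
    + move=> [st4 tr4]; split; first by rewrite eL.
      by exists u, p; split=> //; right.
    + move=> [v tr4]; split; first by rewrite eL.
      exists u, (rcons p v); split=> //.
        by rewrite -rcons_cons mem_rcons inE v0' orbT.
      left; rewrite size_rcons; congr _.+1; case: st' => // st'.
      have := tr_sorted _ _ _ _ _ tr4; rewrite /= rcons_path => /andP[_ /st'].
      have := tr_new _ _ _ _ _ tr4 v.
      rewrite -rcons_cons mem_rcons mem_head => /(_ isT) /negbTE -> /=.
      by have := tr_uniq _ _ _ _ _ tr4; rewrite -rcons_cons rcons_uniq => /andP[/negbTE ->].
  - move=> LO' [u [p [tr' v0' st']]]; split=> //; exists u, p; split=> //.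
    case: st' => // sp; have := uniq_size_le _ _ (tr_uniq _ _ _ _ _ tr').
    by rewrite /= sp ltnn.
set s3 := run (Loop 1 0 STEP 0 extend_left) s2.
(* The bound on [LO] keeps it positive before each round. Being stuck on the right survives, as the
   walk only grows. *)
have := loop_rule inp (fun t s' => n <= s' LO 0 + t /\
    exists u p, [/\ tracing n G vis s' (u :: p), v0 \in u :: p,
      stuck n G vis (u :: p) (last u p) &
      t <= size p \/ stuck n G vis (u :: p) u]) 1 0 STEP 0 extend_left s2.
rewrite bound1 -/s3; case.
- by split; [rewrite LO2 addn0 | exists u0, p0; split=> //; left].
- move=> t s' tn fr [LO' [u [p [tr' v0' st' sl']]]].
  set s4 := set_cell s' STEP 0 t.
  have tr4 : tracing n G vis s4 (u :: p).
    by apply: tracing_frame tr'; rewrite /s4 set_cell_other.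
  have rows4 : rows_ok n s4 by move=> z; rewrite /s4 set_cell_other // fr // e2 // rows1.
  have eL : s4 LO 0 = s' LO 0 by rewrite /s4 set_cell_other.
  have lo0 : 0 < s4 LO 0 by rewrite eL; lia.
  have := extend_leftP n G f0 ft l vis s4 u p symG rows4 lo0 tr4; rewrite -/inp.
  case=> [[h1 [h2 h3]]|[h1 [v h3]]].
  + split; first by rewrite h1 eL; lia.
    by exists u, p; split=> //; right.
  + split; first by rewrite h1 eL; lia.
    exists v, (u :: p); split=> //.
    * by rewrite inE v0' orbT.
    * by move=> z /st'; rewrite /= [z \in v :: _]inE => /orP[->//|->]; rewrite !orbT.
    * left; case: sl' => // sl'.
      have := tr_sorted _ _ _ _ _ h3; rewrite /= symG => /andP[/sl' + _].
      have := tr_new _ _ _ _ _ h3 v; rewrite mem_head => /(_ isT) /negbTE -> /=.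
      by have := tr_uniq _ _ _ _ _ h3; rewrite cons_uniq => /andP[/negbTE ->].
- move=> _ [u [p [tr' v0' st' sl']]]; exists u, p; split=> //.
  case: sl' => // sp; have := uniq_size_le _ _ (tr_uniq _ _ _ _ _ tr').
  by rewrite /= ltnNge sp.
Qed.

End TraceWalk.

(** * Colours, multiplicities and ranks along a walk *)

Section Tables.
Variables (n : nat) (G : rel 'I_n) (f0 ft : placement n) (l : nat).
Let inp := encode_instance G f0 ft l.
Notation run := (sem inp).

Record ready (s : store) (w : seq 'I_n) : Prop := Ready {
  rd_M : s LEN 0 = size w;
  rd_CYC : s CYC 0 = closed_walk n G w;
  rd_CA (x : 'I_(size w)) : s CA x = word n f0 w x;
  rd_CB (x : 'I_(size w)) : s CB x = word n ft w x;
  rd_KA (x : 'I_(size w)) : s KA x = mult _ (word n f0 w) x;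
  rd_RA (x : 'I_(size w)) : s RA x = rank _ (word n f0 w) x;
  rd_RB (x : 'I_(size w)) : s RB x = rank _ (word n ft w) x }.

Lemma ready_frame s s' w :
  (forall a, a \in [:: LEN; CYC; CA; CB; KA; RA; RB] -> s' a = s a) ->
  ready s w -> ready s' w.
Proof.
move=> e [h1 h2 h3 h4 h5 h6 h7].
by split; move=> *; rewrite e.
Qed.

Lemma sub_if a b c (A : Type) (u v : A) : c = (a < b) ->
  (if b - a != 0 then u else v) = if c then u else v.
Proof. by move=> ->; rewrite subn_eq0 -ltnNge. Qed.

Lemma tabulateP vis s u p : rows_ok n s -> tracing n G vis s (u :: p) ->
  ready (run tabulate s) (u :: p).
Proof.
move=> rows tr; have [uw _ _ _ [hi at_w]] := tr.
set w := u :: p in hi at_w uw *.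
have mn : size w <= n := uniq_size_le _ _ uw.
rewrite /tabulate 3!sem_seq; set s1 := run _ (run _ s).
have e1 a : a \notin [:: LEN; CYC] -> s1 a = s a.
  by rewrite !inE !negb_or => /andP[h1 h2]; rewrite /s1 !sem_asg !set_cell_other.
have M1 : s1 LEN 0 = size w.
  by rewrite /s1 !sem_asg /= !get_set /= hi addKn.
have C1 : s1 CYC 0 = closed_walk n G w.
  rewrite /s1 !sem_asg get_set /= !get_set /= hi /= addnS subn1 /=.
  rewrite (at_w _ u) // -[s LO 0]addn0 (at_w _ u) // rows.
  rewrite -/(nth u w (size p)) nth_last -/inp.
  exact: inp_G.
set s2 := run (Loop 1 0 POSX 0 _) s1.
have e2 a : a \notin [:: POSX; CA; CB] -> s2 a = s1 a.
  by apply: sem_frame_sub.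
have word_at (x : 'I_(size w)) : nth u w x = at_ n w x by rewrite /at_ (tnth_nth u).
have AB : forall x : 'I_(size w), x < n -> s2 CA x = word n f0 w x /\ s2 CB x = word n ft w x.
  have := loop_rule inp (fun t s' => forall x : 'I_(size w), x < t ->
     s' CA x = word n f0 w x /\ s' CB x = word n ft w x) 1 0 POSX 0
    copy_colours s1.
  rewrite bound1 -/s2; apply=> // t s' tn fr IH x; rewrite ltnS leq_eqVlt => xt.
  rewrite /copy_colours sem_if /= !get_set /= (fr LEN) // M1 (sub_if _ _ (t < size w)) //.
  case: ltnP => tw; last first.
    rewrite sem_skip !set_cell_other //; apply: IH.
    by case/orP: xt => // /eqP E; have := ltn_ord x; rewrite E ltnNge tw.
  rewrite !semE /= !get_set /= (fr LO) // (fr WALK) // (e1 LO) // (e1 WALK) //.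
  rewrite (at_w _ u) //; case/orP: xt => [/eqP E|xt].
    rewrite E eqxx -E word_at -/inp; split; first exact: inp_f0.
    exact: inp_ft.
  have /negbTE -> : (x : nat) != t by apply/eqP; lia.
  exact: IH.
have {}AB (x : 'I_(size w)) : s2 CA x = word n f0 w x /\ s2 CB x = word n ft w x.
  by apply: AB; apply: leq_trans mn.
set s3 := run _ s2.
have e3 a : a \notin [:: POSX; POSY; KA; RA; RB] -> s3 a = s2 a.
  by apply: sem_frame_sub.
suff KR : forall x : 'I_(size w), x < n -> [/\ s3 KA x = mult _ (word n f0 w) x,
    s3 RA x = rank _ (word n f0 w) x & s3 RB x = rank _ (word n ft w) x].
  have KR' (x : 'I_(size w)) := KR x (leq_trans (ltn_ord x) mn).
  split.
  - by rewrite e3 // e2.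
  - by rewrite e3 // e2.
  - by move=> x; rewrite e3 //; case: (AB x).
  - by move=> x; rewrite e3 //; case: (AB x).
  - by move=> x; case: (KR' x).
  - by move=> x; case: (KR' x).
  - by move=> x; case: (KR' x).
rewrite /s3.
have := loop_rule inp (fun t s' => forall x : 'I_(size w), x < t ->
  [/\ s' KA x = mult _ (word n f0 w) x, s' RA x = rank _ (word n f0 w) x &
      s' RB x = rank _ (word n ft w) x]) 1 0 POSX 0 rank_position s2.
rewrite bound1; apply=> // t s' tn fr IH x; rewrite ltnS leq_eqVlt => xt.
rewrite /rank_position 3!sem_seq 3!sem_asg /= !get_set /=.
set s4 := set_cell _ RB _ _.
have e4 a : a \notin [:: POSX; KA; RA; RB] -> s4 a = s' a.
  by rewrite !inE !negb_or => /and4P[h1 h2 h3 h4]; rewrite /s4 !set_cell_other.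
have X4 : s4 POSX 0 = t by rewrite /s4 !get_set.
have M4 : s4 LEN 0 = size w by rewrite e4 // fr // e2.
have A4 (z : 'I_(size w)) : s4 CA z = word n f0 w z by rewrite e4 // fr //; case: (AB z).
have B4 (z : 'I_(size w)) : s4 CB z = word n ft w z by rewrite e4 // fr //; case: (AB z).
have sumK c i (P : nat -> nat) :
  (forall z s5, z < n -> (forall a, a \notin [:: POSY; KA; RA; RB] -> s5 a = s4 a) ->
     run rank_step (set_cell s5 POSY 0 z) c i = s5 c i + if z < size w then P z else 0) ->
  run (Loop 1 0 POSY 0 rank_step) s4 c i = s4 c i + \sum_(z < size w) P z.
  move=> H; rewrite -(sum_guard _ n P) //.
  have := sum_loop_rule inp (fun z => if z < size w then P z else 0) 1 0 POSY 0 rank_step s4 c i.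
  rewrite bound1; apply=> z s5 zn fr5; apply: H => // a ha; apply: fr5.
have step z s5 : z < n -> (forall a, a \notin [:: POSY; KA; RA; RB] -> s5 a = s4 a) ->
    let s6 := run rank_step (set_cell s5 POSY 0 z) in forall i,
    [/\ s6 KA i = s5 KA i + (if z < size w then (i == t) * (s4 CA z == s4 CA t) else 0),
       s6 RA i = s5 RA i + (if z < size w then (i == t) * ((z < t) && (s4 CA z == s4 CA t)) else 0) &
       s6 RB i = s5 RB i + (if z < size w then (i == t) * ((z < t) && (s4 CB z == s4 CB t)) else 0)].
  move=> zn fr5 s6 i; rewrite /s6 /rank_step sem_if /= !get_set /= fr5 // M4.
  rewrite (sub_if _ _ (z < size w)) //; case: ltnP => zw; last first.
    by rewrite sem_skip !set_cell_other ?addn0.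
  rewrite !semE /= !get_set /= !eqn_expr !ltn_expr !and_expr (fr5 POSX) // (fr5 CA) // (fr5 CB) // X4.
  by case: (eqVneq i t) => [->|_]; rewrite ?mul1n ?mul0n ?addn0.
have K i := sumK KA i (fun z => (i == t) * (s4 CA z == s4 CA t))
  (fun z s5 zn h => let: And3 h1 _ _ := step z s5 zn h i in h1).
have RAi i := sumK RA i (fun z => (i == t) * ((z < t) && (s4 CA z == s4 CA t)))
  (fun z s5 zn h => let: And3 _ h1 _ := step z s5 zn h i in h1).
have RBi i := sumK RB i (fun z => (i == t) * ((z < t) && (s4 CB z == s4 CB t)))
  (fun z s5 zn h => let: And3 _ _ h1 := step z s5 zn h i in h1).
have KA4 i : s4 KA i = if i == t then 0 else s' KA i by rewrite /s4 !get_set.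
have RA4 i : s4 RA i = if i == t then 0 else s' RA i by rewrite /s4 !get_set.
have RB4 i : s4 RB i = if i == t then 0 else s' RB i by rewrite /s4 !get_set.
rewrite K RAi RBi KA4 RA4 RB4.
have [E|ne] := eqVneq (x : nat) t; last first.
  have xt' : x < t by case/orP: xt ne => // /eqP ->; rewrite eqxx.
  by rewrite !big1 // !addn0; apply: IH.
rewrite -E !add0n A4 B4; split; apply: eq_bigr => z _; rewrite mul1n ?A4 ?B4 //.
Qed.

End Tables.

(** * Turns and target of one position, by division with remainder *)

Section Evaluation.
Variables (n : nat) (G : rel 'I_n) (f0 ft : placement n) (l c : nat).
Let inp := encode_instance G f0 ft l.
Notation run := (sem inp).
Variable w : seq 'I_n.
Hypothesis uw : uniq w.
Notation m := (size w).
Notation a := (word n f0 w).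
Notation b := (word n ft w).
Notation ready := (ready n G f0 ft).

Definition target u (x y : 'I_m) : Prop :=
  b y = a x /\ rank _ b y = shifted_rank _ a u n.*2 x %% mult _ a x.

(** The quotient counts every round until the remainder drops below [k], after which the loop idles;
    the bound on [idx] ensures that this happens in time. *)
Lemma divide_loopP s k idx N : s KA (s POSX 0) = k -> 0 < k -> s IDX 0 = idx -> s QUO 0 = 0 ->
  idx < (N * n).+1 * k ->
  let s' := run (Loop N 0 STEP 0 divide_step) s in s' IDX 0 = idx %% k /\ s' QUO 0 = idx %/ k.
Proof.
move=> sk k0 si sq lt s'.
have := loop_rule inp (fun t s' => idx = s' QUO 0 * k + s' IDX 0 /\
   (s' IDX 0 < k \/ s' QUO 0 = t)) N 0 STEP 0 divide_step s.
rewrite -/s'; case.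
- by rewrite sq si; split=> //; right.
- move=> t s1 tN fr [h1 h2]; rewrite /divide_step sem_if /= !get_set /=.
  rewrite (fr KA) // (fr POSX) // sk subn_eq0 -ltnNge; case: ltnP => h3.
    by rewrite sem_skip !set_cell_other //; split=> //; left.
  rewrite !semE /= !get_set /= (fr KA) // (fr POSX) // sk; split.
    by rewrite {1}h1 mulnDl mul1n; lia.
  by right; case: h2 => [|->]; lia.
- rewrite /bound inp_n addn0 => h1 h2.
  have h3 : s' IDX 0 < k.
    case: h2 => // h2; rewrite h1 h2 mulSn in lt; lia.
  by rewrite h1 divnMDl // divn_small // addn0 modnMDl modn_small.
Qed.

Lemma search_targetP s (x : 'I_m) u : ready s w -> s POSX 0 = x -> s FND 0 = 0 ->
  s IDX 0 = shifted_rank _ a u n.*2 x %% mult _ a x ->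
  let s' := run (Loop 1 0 POSY 0 search_target) s in
  (forall i : nat, i <> x -> s' DEST i = s DEST i) /\
  ((s' FND 0 = 1 /\ exists2 y, target u x y & s' DEST x = y) \/
   (s' FND 0 = 0 /\ forall y, ~ target u x y)).
Proof.
move=> rd sX sF sI s'; have mn := uniq_size_le _ _ uw.
have := loop_rule inp (fun t s' => (forall i : nat, i <> x -> s' DEST i = s DEST i) /\
  ((s' FND 0 = 1 /\ exists2 y, target u x y & s' DEST x = y) \/
   (s' FND 0 = 0 /\ forall y : 'I_m, y < t -> ~ target u x y))) 1 0 POSY 0 search_target s.
rewrite bound1 -/s'; case.
- by split=> //; right.
- move=> t s1 tn fr [h1 h2]; rewrite /search_target sem_if /= !get_set /=.
  rewrite (fr LEN) // (rd_M _ _ _ _ _ _ rd) (sub_if _ _ (t < m)) //.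
  case: ltnP => tm; last first.
    rewrite sem_skip !set_cell_other //; split=> //.
    case: h2 => [|[h2 h3]]; [by left|right; split=> // y _].
    by apply: h3; apply: leq_trans tm.
  pose y := Ordinal tm.
  rewrite !sem_if !sem_skip /= !get_set /= !dist_expr.
  rewrite (fr CB) // (fr CA) // (fr POSX) // sX (rd_CA _ _ _ _ _ _ rd) (fr RB) //.
  rewrite (rd_CB _ _ _ _ _ _ rd y) (rd_RB _ _ _ _ _ _ rd y) (fr IDX) // sI.
  have no : ~ target u x y -> (forall i : nat, i <> x -> set_cell s1 POSY 0 t DEST i = s DEST i) /\
    ((set_cell s1 POSY 0 t FND 0 = 1 /\ exists2 y, target u x y & set_cell s1 POSY 0 t DEST x = y) \/
     (set_cell s1 POSY 0 t FND 0 = 0 /\ forall y : 'I_m, y < t.+1 -> ~ target u x y)).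
    move=> nt; rewrite !set_cell_other //; split=> //.
    case: h2 => [|[h2 h3]]; [by left|right; split=> // z].
    rewrite ltnS leq_eqVlt => /orP[/eqP zt|]; last exact: h3.
    by rewrite (_ : z = y) //; apply: val_inj.
  case: eqP => [e1|ne]; last by apply: no => -[].
  case: eqP => [e2|ne]; last by apply: no => -[].
  rewrite !semE /= !get_set /= (fr POSX) // sX eqxx; split.
    by move=> i ix; rewrite !get_set /=; case: eqP => // _; apply: h1.
  by left; split=> //; exists y.
- move=> h1 [h2|[h2 h3]]; split=> //; [by left|right; split=> // y].
  by apply: h3; apply: leq_trans mn.
Qed.

Lemma encode_positionP s (x : 'I_m) : ready s w -> s POSX 0 = x ->
  s PHI (a x) <= (c.*2 + 4) * n ->
  let u := s PHI in let s' := run (encode_position c) s in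
  let q := shifted_rank _ a u n.*2 x %/ mult _ a x in
  [/\ (forall i : nat, s' WIND i = if i == x then q else s WIND i),
      s' POS_SUM 0 = s POS_SUM 0 + (q - n.*2), s' NEG_SUM 0 = s NEG_SUM 0 + (n.*2 - q),
      (forall i : nat, i <> x -> s' DEST i = s DEST i) &
      (s' VALID 0 = s VALID 0 /\ exists2 y, target u x y & s' DEST x = y) \/
      (s' VALID 0 = 0 /\ forall y, ~ target u x y)].
Proof.
move=> rd sX ub u s' q.
set idx := shifted_rank _ _ _ _ _ in q *; set k := mult _ _ _ in q *.
have k0 : 0 < k := mult_gt0 _ a x.
rewrite {}/s' /encode_position sem_seq; set s1 := run _ s.
have e1 a' : a' != IDX -> s1 a' = s a' by move=> h; rewrite /s1 sem_asg set_cell_other.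
have I1 : s1 IDX 0 = rank _ a x + u (a x).
  by rewrite /s1 sem_asg get_set /= sX (rd_RA _ _ _ _ _ _ rd) (rd_CA _ _ _ _ _ _ rd).
rewrite sem_seq; set s2 := run _ s1.
have e2 a' : a' \notin [:: IDX; STEP] -> s2 a' = s1 a' by apply: sem_frame_sub.
have I2 : s2 IDX 0 = rank _ a x + u (a x) + n.*2 * k.
  have := sum_loop_rule inp (fun=> k) 2 0 STEP 0 add_multiplicity s1 IDX 0.
  rewrite -/s2 => ->.
    by rewrite I1 sum_nat_const card_ord /bound inp_n addn0 mul2n.
  move=> t s5 _ fr; rewrite /add_multiplicity !semE /= !get_set /=.
  by rewrite (fr KA) // (fr POSX) // !e1 // sX (rd_KA _ _ _ _ _ _ rd).
rewrite 2!sem_seq; set s3 := run _ (run _ s2).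
have e3 a' : a' \notin [:: IDX; STEP; QUO] -> s3 a' = s a'.
  rewrite !inE !negb_or => /and3P[h1 h2 h3].
  rewrite /s3 !sem_asg !set_cell_other // e2 ?e1 //.
  by rewrite !inE !negb_or h1.
have I3 : s3 IDX 0 = idx.
  by rewrite /s3 !semE /= !get_set /= ?inp_n I2 addnn.
have Q3 : s3 QUO 0 = 0 by rewrite /s3 !semE /= !get_set.
rewrite sem_seq; set s4 := run _ s3.
have e4 a' : a' \notin [:: IDX; STEP; QUO] -> s4 a' = s a'.
  move=> h; rewrite -e3 //; apply: sem_frame_sub h => //.
have [I4 Q4] : s4 IDX 0 = idx %% k /\ s4 QUO 0 = q.
  apply: divide_loopP => //; first by rewrite !e3 // sX (rd_KA _ _ _ _ _ _ rd).
  have h1 := rank_lt_mult _ a x;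
  have h2 : u (a x) <= (c.*2 + 4) * n * k by apply: leq_trans ub (leq_pmulr _ k0).
  rewrite /idx /shifted_rank -/k mulSn.
  (* 2c+4 for the flux, 2 for the offset and 1 to spare; the rank is covered by the additional
     [k]. *)
  have -> : (c.*2 + 7) * n * k = (c.*2 + 4) * n * k + (n.*2 * k + n * k).
    by rewrite -mulnDl -[RHS]mulnDl; congr (_ * _); nia.
  move: ((c.*2 + 4) * n * k) h2 => A h2; move: (n.*2 * k) (n * k) => B C; lia.
rewrite 2!sem_seq; set s5 := run _ (run _ s4).
have e5 a' : a' \notin [:: IDX; STEP; QUO; WIND; FND] -> s5 a' = s a'.
  rewrite !inE !negb_or => /and5P[h1 h2 h3 h4 h5].
  rewrite /s5 !sem_asg !set_cell_other // e4 //.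
  by rewrite !inE !negb_or h1 h2 h3.
have Q5 i : s5 WIND i = if i == x then q else s WIND i.
  by rewrite /s5 !semE /= !get_set /= (e4 POSX) // sX Q4 (e4 WIND).
have rd5 : ready s5 w.
  by apply: ready_frame rd => a' h; apply: e5; move: h; rewrite !inE;
     do 6?[case/orP=> [/eqP -> //|]]; move/eqP->.
rewrite sem_seq; set s6 := run _ s5.
have e6 a' : a' \notin [:: POSY; FND; DEST] -> s6 a' = s5 a' by apply: sem_frame_sub.
have [R6 F6] : (forall i : nat, i <> x -> s6 DEST i = s DEST i) /\
  ((s6 FND 0 = 1 /\ exists2 y, target u x y & s6 DEST x = y) \/
   (s6 FND 0 = 0 /\ forall y, ~ target u x y)).
  rewrite -(e5 DEST) //; apply: search_targetP => //.
  - by rewrite e5.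
have X6 : s6 QUO 0 = q by rewrite e6 // /s5 !semE /= !get_set.
rewrite !semE; set s7 := (if _ then _ else _).
have e7 a' : a' != VALID -> s7 a' = s6 a' by rewrite /s7; case: ifP => // _ h; rewrite set_cell_other.
rewrite /= !get_set /= ?inp_n addnn (e7 QUO) // (e7 POS_SUM) // (e7 NEG_SUM) // X6.
rewrite (e6 POS_SUM) // (e6 NEG_SUM) // (e5 POS_SUM) // (e5 NEG_SUM) //.
split=> //.
- by move=> i; rewrite !set_cell_other // e7 // e6 // Q5.
- by move=> i h; rewrite !set_cell_other // e7 // R6.
- rewrite /s7 /=; case: F6 => -[h1 h2]; rewrite h1 /=; [left|right]; split=> //.
  + by rewrite e6 // e5.
Qed.

End Evaluation.

(** * Evaluating one choice of fluxes *)

Section Search.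
Variables (n : nat) (G : rel 'I_n) (f0 ft : placement n) (l c : nat).
Let inp := encode_instance G f0 ft l.
Notation run := (sem inp).
Variable w : seq 'I_n.
Hypothesis uw : uniq w.
Notation m := (size w).
Notation a := (word n f0 w).
Notation b := (word n ft w).
Notation ready := (ready n G f0 ft).
Notation target := (target n f0 ft w).
Notation closed := (closed_walk n G w).

Definition quotient u x := shifted_rank _ a u n.*2 x %/ mult _ a x.

Lemma encode_allP s : ready s w -> (forall x, s PHI (a x) <= (c.*2 + 4) * n) ->
  let u := s PHI in let s' := run (encode_all c) s in
  [/\ forall x : 'I_m, s' WIND x = quotient u x,
      s' POS_SUM 0 = \sum_x (quotient u x - n.*2), s' NEG_SUM 0 = \sum_x (n.*2 - quotient u x) &
      (s' VALID 0 = 1 /\ forall x : 'I_m, exists2 y, target u x y & s' DEST x = y) \/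
      (s' VALID 0 = 0 /\ exists x, forall y, ~ target u x y)].
Proof.
move=> rd ub u s'; have mn := uniq_size_le _ _ uw.
rewrite {}/s' /encode_all 3!sem_seq; set s1 := run _ (run _ (run _ s)).
have e1 a' : a' \notin [:: VALID; POS_SUM; NEG_SUM] -> s1 a' = s a'.
  by rewrite !inE !negb_or => /and3P[h1 h2 h3]; rewrite /s1 !sem_asg !set_cell_other.
set s' := run _ s1.
pose qn z := if insub z is Some x then quotient u x else 0.
have qnE (x : 'I_m) : qn x = quotient u x by rewrite /qn valK.
have := loop_rule inp (fun t s' => [/\ forall x : 'I_m, x < t -> s' WIND x = quotient u x,
   s' POS_SUM 0 = \sum_(z < t) (if z < m then qn z - n.*2 else 0),
   s' NEG_SUM 0 = \sum_(z < t) (if z < m then n.*2 - qn z else 0) &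
   (s' VALID 0 = 1 /\ forall x : 'I_m, x < t -> exists2 y, target u x y & s' DEST x = y) \/
   (s' VALID 0 = 0 /\ exists x, forall y, ~ target u x y)]) 1 0 POSX 0
   (If (Sub (Var LEN) (Var POSX)) (encode_position c) Skip) s1.
rewrite bound1 -/s'; case.
- split=> //; rewrite ?big_ord0 /s1 ?sem_asg ?get_set //=.
  by left; rewrite ?get_set.
- move=> t s2 tn fr [hQ h1 h2 hR].
  rewrite sem_if [eval _ _ _]/= !get_set [_ && _]/= (fr LEN) // (e1 LEN) //.
  rewrite (rd_M _ _ _ _ _ _ rd) (sub_if _ _ (t < m)) //; set s3 := set_cell s2 POSX 0 t.
  rewrite 2!big_ord_recr /=; case: ltnP => tm; last first.
    rewrite sem_skip !addn0; split=> //.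
      by move=> x _; apply: hQ; apply: leq_trans tm.
    case: hR => [[o hR]|]; [left; split=> // x _|by right].
    by apply: hR; apply: leq_trans tm.
  have rd3 : ready s3 w.
    apply: ready_frame rd => a' h; rewrite /s3 set_cell_other; last first.
      by move: h; rewrite !inE; do 6?[case/orP=> [/eqP -> //|]]; move/eqP->.
    by move: h; rewrite !inE; do 6?[case/orP=> [/eqP ->|]]; try move/eqP->; rewrite fr // e1.
  pose x := Ordinal tm.
  have X3 : s3 POSX 0 = x by rewrite /s3 get_set.
  have P3 : s3 PHI = u by rewrite /s3 set_cell_other // fr // e1.
  have ub3 : s3 PHI (a x) <= (c.*2 + 4) * n by rewrite P3.
  have := encode_positionP n G f0 ft l c w uw s3 x rd3 X3 ub3.
  rewrite P3 -/inp -/(quotient u x); case=> q1 q2 q3 q4 q5.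
  have qt : qn t = quotient u x := qnE x.
  have split_lt (y : 'I_m) : y < t.+1 -> y = x \/ y < t.
    rewrite ltnS leq_eqVlt => /orP[/eqP yt|]; [left; exact: val_inj|by right].
  split.
  + move=> y /split_lt[->|yt]; rewrite q1; first by rewrite eqxx.
    rewrite ifN; first by rewrite /s3 set_cell_other // hQ.
    by apply/eqP => yx; move: yt; rewrite yx ltnn.
  + by rewrite q2 qt -h1 /s3 set_cell_other.
  + by rewrite q3 qt -h2 /s3 set_cell_other.
  + case: q5 => [[o [y t1 t2]]|[o no]]; last by right; split=> //; exists x.
    case: hR => [[o' hR]|[o' no]]; last first.
      by right; split=> //; rewrite o /s3 set_cell_other.
    left; split; first by rewrite o /s3 set_cell_other.
    move=> z /split_lt[->|zt]; first by exists y.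
    have [y' t1' t2'] := hR z zt; exists y' => //.
    rewrite q4 /s3 ?set_cell_other //; move=> zx; move: zt; rewrite zx ltnn //.
- move=> hQ h1 h2 hR; split.
  + by move=> x; apply: hQ; apply: leq_trans mn.
  + rewrite h1 (sum_guard _ n (fun z => qn z - n.*2)) //.
    by apply: eq_bigr => x _; rewrite qnE.
  + rewrite h2 (sum_guard _ n (fun z => n.*2 - qn z)) //.
    by apply: eq_bigr => x _; rewrite qnE.
  + case: hR => [[o hR]|]; [left; split=> // x|by right].
    by apply: hR; apply: leq_trans mn.
Qed.

Lemma count_crossingsP s (Qf : 'I_m -> nat) (Rf : 'I_m -> 'I_m) : s LEN 0 = m ->
  (forall x : 'I_m, s WIND x = Qf x) -> (forall x : 'I_m, s DEST x = Rf x) ->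
  run count_crossings s CROSS 0 = crossing_number _ Qf Rf.
Proof.
move=> sM sQ sR; have mn := uniq_size_le _ _ uw.
pose term x y := (s WIND y + (y < x) - (s WIND x + (s DEST y < s DEST x))) +
                 (s WIND x + (s DEST y < s DEST x) - (s WIND y + (y < x))).
rewrite /count_crossings sem_seq; set s1 := run _ s.
have e1 a' : a' != CROSS -> s1 a' = s a' by move=> h; rewrite /s1 sem_asg set_cell_other.
pose FF x := \sum_(y < n) if x < m then if y < m then term x y else 0 else 0.
have := sum_loop_rule inp FF 1 0 POSX 0 (Loop 1 0 POSY 0 crossing_step) s1 CROSS 0.
rewrite bound1 => ->; last first.
  move=> t s2 tn fr; set s3 := set_cell s2 POSX 0 t.
  have := sum_loop_rule inp (fun y => if t < m then if y < m then term t y else 0 else 0)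
    1 0 POSY 0 crossing_step s3 CROSS 0.
  rewrite bound1 => ->; first by rewrite /s3 set_cell_other.
  move=> y s4 yn fr4.
  have e4 a' : a' \notin [:: POSX; POSY; CROSS] -> s4 a' = s a'.
    rewrite !inE !negb_or => /and3P[h1 h2 h3].
    rewrite fr4; last by rewrite !inE !negb_or h2 h3.
    rewrite /s3 set_cell_other // fr ?e1 //.
    by rewrite !inE !negb_or h1 h2 h3.
  have X4 : s4 POSX 0 = t by rewrite fr4 // /s3 get_set.
  rewrite /crossing_step !semE /= !get_set /= (e4 LEN) // sM X4.
  rewrite (sub_if t m (t < m)) // (sub_if y m (y < m)) //.
  case: ltnP => _; last by rewrite set_cell_other ?addn0.
  case: ltnP => _; last by rewrite set_cell_other ?addn0.
  by rewrite get_set /= !ltn_expr (e4 WIND) // (e4 DEST) // X4.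
rewrite {1}/s1 sem_asg get_set /= add0n /FF /crossing_number.
have -> : \sum_(x < n) \sum_(y < n) (if x < m then if y < m then term x y else 0 else 0) =
  \sum_(x < n) (if x < m then \sum_(y < m) term x y else 0).
  apply: eq_bigr => x _; case: ifP => _; last by rewrite big1.
  exact: (sum_guard _ n (term x)).
rewrite (sum_guard _ n (fun x => \sum_(y < m) term x y)) //.
by apply: eq_bigr => x _; apply: eq_bigr => y _; rewrite /term !sQ !sR.
Qed.

Definition admissible u k := exists Qf Rf,
  [/\ encodes _ a b u n.*2 Qf Rf, balanced _ closed n.*2 Qf & k = crossing_number _ Qf Rf].

(** The quotients fix the turns; colour and rank fix the targets. *)
Lemma admissible_uniq u k k' : admissible u k -> admissible u k' -> k = k'.
Proof.
move=> [Qf [Rf [e1 _ ->]]] [Qf' [Rf' [e2 _ ->]]].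
have EQ x : Qf x = Qf' x by case: (e1 x) (e2 x) => -> _ _ [-> _ _].
have ER x : Rf x = Rf' x.
  case: (e1 x) (e2 x) => _ h1 h2 [_ h3 h4].
  by apply: (rank_inj _ b); rewrite ?h1 ?h3 // h2 h4.
by apply: eq_bigr => x _; apply: eq_bigr => y _; rewrite !EQ !ER.
Qed.

Definition improves (U : (nat -> nat) -> Prop) k k' :=
  [/\ k' <= k, k' = k \/ (exists u, admissible u k') &
      forall u v, U u -> admissible u v -> k' <= v].

Lemma evaluateP s : ready s w -> (forall x, s PHI (a x) <= (c.*2 + 4) * n) ->
  improves (fun u => forall x, u (a x) = s PHI (a x)) (s BEST 0) (run (evaluate c) s BEST 0).
Proof.
move=> rd ub; rewrite /evaluate 2!sem_seq.
set s1 := run _ s; set s2 := run _ s1.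
have [hQ h1 h2 hR] := encode_allP s rd ub; rewrite -/inp -/s1 in hQ h1 h2 hR.
have e1 a' :
    a' \notin [:: VALID; POS_SUM; NEG_SUM; POSX; IDX; STEP; QUO; WIND; FND; POSY; DEST] -> s1 a' = s a'.
  by apply: sem_frame_sub.
have e2 a' : a' \notin [:: POSX; POSY; CROSS] -> s2 a' = s1 a' by apply: sem_frame_sub.
have ext u v : (forall x, u (a x) = s PHI (a x)) -> admissible u v -> admissible (s PHI) v.
  move=> uE [Qf [Rf [enc bal vE]]]; exists Qf, Rf; split=> // x.
  by have [g1 g2 g3] := enc x; rewrite /shifted_rank -uE.
have no : (forall v, ~ admissible (s PHI) v) ->
    improves (fun u => forall x, u (a x) = s PHI (a x)) (s BEST 0) (s BEST 0).
  move=> nv; split=> //; first by left.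
  by move=> u v /ext h /h /nv.
rewrite /update_best !semE /= !dist_expr (e2 VALID) //.
rewrite (e2 POS_SUM) // (e2 NEG_SUM) // (e2 CYC) // (e2 BEST) //.
rewrite !(e1 CYC) // (rd_CYC _ _ _ _ _ _ rd) (e1 BEST) //.
case: hR => [[o hR]|[o [x nx]]]; rewrite o /=; last first.
  rewrite e2 // e1 //; apply: no => v [Qf [Rf [enc _ _]]].
  by have [_ g1 g2] := enc x; apply: (nx (Rf x)).
have [Rf tR sR] := fin_all_exists2 hR.
have enc : encodes _ a b (s PHI) n.*2 (quotient (s PHI)) Rf.
  by move=> x; case: (tR x).
have cE : s2 CROSS 0 = crossing_number _ (quotient (s PHI)) Rf.
  apply: count_crossingsP => //; rewrite e1 //; exact: (rd_M _ _ _ _ _ _ rd).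
have balE : balanced _ closed n.*2 (quotient (s PHI)) =
    (s1 POS_SUM 0 == s1 NEG_SUM 0) && (closed || (s1 POS_SUM 0 == 0)).
  by rewrite /balanced h1 h2.
have nb : ~~ balanced _ closed n.*2 (quotient (s PHI)) -> forall v, ~ admissible (s PHI) v.
  move=> nb v [Qf' [Rf' [enc' bal' _]]]; case/negP: nb.
  have EQ x : quotient (s PHI) x = Qf' x by case: (enc' x) => -> _ _.
  have -> : balanced m closed n.*2 (quotient (s PHI)) = balanced m closed n.*2 Qf'.
    by rewrite !balanced_sum; congr (_ && (_ || _));
      [congr (_ == _); apply: eq_bigr|apply: eq_forallb] => x; rewrite EQ.
  exact: bal'.
case: eqP balE => [_ balE|_ balE] /=; last first.
  by rewrite e2 // e1 //; apply: no; apply: nb; rewrite balE.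
have -> : (closed + (1 - s1 POS_SUM 0) != 0) = (closed || (s1 POS_SUM 0 == 0)).
  by case: (closed) => //=; case: (s1 POS_SUM 0).
case: ifP => hb; last first.
  by rewrite e2 // e1 //; apply: no; apply: nb; rewrite balE hb.
rewrite hb in balE.
have adm : admissible (s PHI) (s2 CROSS 0) by exists (quotient (s PHI)), Rf.
rewrite subn_eq0 -ltnNge; case: ltnP => lt; [rewrite get_set /= | rewrite e2 // e1 //].
- split; [exact: ltnW|by right; exists (s PHI)|].
  by move=> u v /ext h /h /(admissible_uniq _ _ _ adm) ->.
- split=> //; first by left.
  by move=> u v /ext h /h /(admissible_uniq _ _ _ adm) <-.
Qed.

End Search.

Definition search_mods :=
  [:: PHI; VALID; POS_SUM; NEG_SUM; POSX; IDX; STEP; QUO; WIND; FND; POSY; DEST; CROSS; BEST].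

Lemma mods_search c j : all (fun x => x \in search_mods) (mods (search c j)).
Proof. by elim: j => //= j ->. Qed.

(** * The minimum over all choices of fluxes *)

Section SearchLoop.
Variables (n : nat) (G : rel 'I_n) (f0 ft : placement n) (l c : nat).
Let inp := encode_instance G f0 ft l.
Notation run := (sem inp).
Hypothesis f0c : forall v, 0 < f0 v <= c.
Variable w : seq 'I_n.
Hypothesis uw : uniq w.
Notation a := (word n f0 w).
Notation improves := (improves n G f0 ft w).

Lemma improves_trans U1 U2 (U : (nat -> nat) -> Prop) k1 k2 k3 :
  (forall u, U u -> U1 u \/ U2 u) ->
  improves U1 k1 k2 -> improves U2 k2 k3 -> improves U k1 k3.
Proof.
move=> sub [h1 h2 h3] [h4 h5 h6]; split; first exact: leq_trans h4 h1.
- by case: h5 => [->|]; [|right].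
- move=> u v /sub[hu|hu] av; last exact: (h6 u).
  exact: leq_trans h4 (h3 _ _ hu av).
Qed.

Lemma improves_sub U1 (U : (nat -> nat) -> Prop) k k' : (forall u, U u -> U1 u) ->
  improves U1 k k' -> improves U k k'.
Proof. by move=> sub [h1 h2 h3]; split=> // u v /sub; apply: h3. Qed.

Definition flux_choice (phi : nat -> nat) j (u : nat -> nat) : Prop :=
  [/\ forall i, j < i < c -> u i = phi i, forall i, u i <= 4 * n &
      u c = c * n.*2 - \sum_(1 <= i < c) u i].

(** Level [j] keeps the entries strictly between [j] and [c] fixed, so the rounds of the loop at
    level [j.+1] split the choices by the value of that entry. *)
Lemma searchP j s : j < c -> ready n G f0 ft s w ->
  (forall i, j < i < c -> s PHI i <= 4 * n) ->
  let s' := run (search c j) s in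
  (forall i, j < i < c -> s' PHI i = s PHI i) /\
  improves (flux_choice (s PHI) j) (s BEST 0) (s' BEST 0).
Proof.
elim: j s => [|j IH] s jc rd ub.
  rewrite /search sem_seq; set s1 := run _ s.
  have P1 i : s1 PHI i = if i == c then c * n.*2 - \sum_(1 <= i < c) s PHI i else s PHI i.
    rewrite /s1 sem_asg get_set /=; case: eqP => // _.
    by rewrite eval_mulE eval_sumE /= prednK // addnn.
  have rd1 : ready n G f0 ft s1 w.
    apply: ready_frame rd => a' h; rewrite /s1 sem_asg set_cell_other //.
    by move: h; rewrite !inE; do 6?[case/orP=> [/eqP -> //|]]; move/eqP->.
  (* The last shifted flux can reach 2cn and the others 4n; hence the bound (2c+4)n. *)
  have ub1 x : s1 PHI (a x) <= (c.*2 + 4) * n.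
    rewrite P1 /word; have := f0c (at_ n w x); case: eqP => [_ _|ne h].
      apply: leq_trans (leq_subr _ _) _; nia.
    have := ub (f0 (at_ n w x)); rewrite /word in ne *; move=> /(_ ltac:(lia)); nia.
  split.
    move=> i ic; rewrite sem_frame // P1; case: eqP => // ?; lia.
  have -> : s BEST 0 = s1 BEST 0 by rewrite /s1 sem_asg set_cell_other.
  apply: improves_sub (evaluateP n G f0 ft l c w uw s1 rd1 ub1) => u [h1 h2 h3] x.
  rewrite P1; case: eqP => [->|ne].
    by rewrite h3; congr (_ - _); apply: eq_big_nat => i ic; rewrite h1.
  by apply: h1; have := f0c (at_ n w x); rewrite /word in ne *; lia.
rewrite /search -/search.
set s' := run _ s.
have := loop_rule inp (fun t s' => (forall i, j.+1 < i < c -> s' PHI i = s PHI i) /\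
  improves (fun u => flux_choice (s PHI) j.+1 u /\ u j.+1 < t) (s BEST 0) (s' BEST 0))
  4 1 PHI j.+1 (search c j) s.
rewrite -/s'; case.
- by split=> //; split=> //; [left|move=> u v []].
- move=> t s2 tn fr [h1 h2].
  have t4 : t <= 4 * n by move: tn; rewrite /bound inp_n; lia.
  set s3 := set_cell s2 PHI j.+1 t.
  have P3 i : s3 PHI i = if i == j.+1 then t else s2 PHI i by rewrite /s3 get_set.
  have rd3 : ready n G f0 ft s3 w.
    have nin a' : a' \in [:: LEN; CYC; CA; CB; KA; RA; RB] -> a' \notin search_mods.
      by rewrite !inE; do 6?[case/orP=> [/eqP -> //|]]; move/eqP->.
    apply: ready_frame rd => a' /nin h; rewrite /s3 set_cell_other; last first.
      by apply: contraNneq h => ->.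
    apply: fr; rewrite inE negb_or; apply/andP; split.
      by apply: contraNneq h => ->.
    exact: notin_sub (mods_search c j) h.
  have ub3 i : j < i < c -> s3 PHI i <= 4 * n.
    by move=> ic; rewrite P3; case: eqP => // ne; rewrite h1 ?ub //; lia.
  have [k1 k2] := IH s3 (ltnW jc) rd3 ub3.
  split.
    by move=> i ic; rewrite k1 ?P3 ?ifN ?h1 //; [apply/eqP|]; lia.
  apply: improves_trans h2 k2 => u [[g1 g2 g3]]; rewrite ltnS leq_eqVlt.
  case/orP=> [/eqP ut|ut]; last by left.
  right; split=> // i ic; rewrite P3; case: eqP => [->//|ne].
  by rewrite h1 ?g1 //; lia.
- move=> h1 h2; split=> //; apply: improves_sub h2 => u hu; split=> //.
  by case: hu => _ h _; rewrite /bound inp_n; have := h j.+1; lia.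
Qed.

(* The search starts from [l.*2.+1], so larger costs are cut off there. *)
Definition exact_cost k : Prop :=
  (k <= l.*2 -> feasible n G f0 ft w k) /\
  (forall k', order_feasible n G f0 ft w k' -> k <= k').

(** At level [c.-1] every flux below [c] is free, so the completeness of the encoding applies to the
    minimum found. *)
Lemma improves_exact k : 0 < c ->
  improves (flux_choice (fun=> 0) c.-1) l.*2.+1 k -> exact_cost k.
Proof.
move=> c0 [h1 h2 h3]; split.
  move=> kl; case: h2 => [E|[u [Qf [Rf [enc bal ->]]]]]; first by move: kl; rewrite E ltnn.
  exact: encodes_feasible enc bal.
move=> k' /(order_feasible_encodes _ _ _ _ _ c) [//|//|//|].
move=> u [Qf [Rf [enc bal le ub uc]]]; apply: leq_trans le; apply: (h3 u).
- split=> // [i|i]; first lia.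
  by have := ub i; lia.
- by exists Qf, Rf.
Qed.

End SearchLoop.

(** * The whole graph as a union of walks *)

Section Main.
Variables (n : nat) (G : rel 'I_n) (f0 ft : placement n) (l c : nat).
Let inp := encode_instance G f0 ft l.
Notation run := (sem inp).
Hypothesis simpleG : simple_graph G.
Hypothesis degG : max_degree_le G 2.
Hypothesis f0c : forall v, 0 < f0 v <= c.
Hypothesis c_gt0 : 0 < c.

Notation exact_cost := (exact_cost n G f0 ft l).

Lemma processP vis s (v0 : 'I_n) : rows_ok n s -> s START 0 = v0 ->
  (forall v : 'I_n, (s VIS v != 0) = vis v) -> ~~ vis v0 ->
  let s' := run (process c) s in
  exists u p k, let w := u :: p in
   [/\ tracing n G vis s' w, v0 \in w,
       stuck n G vis w (last u p) /\ stuck n G vis w u,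
       s' TOT 0 = s TOT 0 + k & exact_cost w k].
Proof.
move=> rows sV sVIS nv; case: (simpleG) => _ symG.
rewrite /process 4!sem_seq.
set s1 := run trace_walk s; set s2 := run tabulate s1; set s3 := run (Put BEST _) s2.
set s4 := run (search c c.-1) s3.
have [u [p [tr v0w st1 st2]]] := trace_walkP n G f0 ft l vis s v0 symG rows sV sVIS nv.
rewrite -/inp -/s1 in tr; set w := u :: p in tr v0w st1 st2 *.
have uw : uniq w := tr_uniq _ _ _ _ _ tr.
have e1 a : a \notin [:: LO; HI; WALK; VIS; CUR; FND; POSY; NXT; STEP] -> s1 a = s a.
  by apply: sem_frame_sub.
have rows1 : rows_ok n s1 by move=> z; rewrite e1 // rows.
have rd2 : ready n G f0 ft s2 w := tabulateP n G f0 ft l vis s1 u p rows1 tr.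
have e2 a : a \notin [:: LEN; CYC; POSX; CA; CB; KA; RA; RB; POSY] -> s2 a = s1 a.
  by apply: sem_frame_sub.
have e3 a : a != BEST -> s3 a = s2 a by move=> h; rewrite /s3 sem_asg set_cell_other.
have rd3 : ready n G f0 ft s3 w.
  apply: ready_frame rd2 => a h; apply: e3.
  by move: h; rewrite !inE; do 6?[case/orP=> [/eqP -> //|]]; move/eqP->.
have e4 a : a \notin search_mods -> s4 a = s3 a by apply: sem_frame_sub; apply: mods_search.
have cc : c.-1 < c by rewrite prednK.
have ub3 i : c.-1 < i < c -> s3 PHI i <= 4 * n by lia.
have [_ imp] := searchP n G f0 ft l c f0c w uw c.-1 s3 cc rd3 ub3.
rewrite -/inp -/s4 in imp.
have B3 : s3 BEST 0 = l.*2.+1 by rewrite /s3 sem_asg get_set /= ?inp_l addnn addn1.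
rewrite B3 in imp.
exists u, p, (s4 BEST 0); split=> //.
- by apply: tracing_frame tr; rewrite sem_asg set_cell_other // e4 // e3 // e2.
- by rewrite sem_asg get_set /= e4 // e3 // e2 // e1.
- apply: (improves_exact n G f0 ft l c f0c w uw) => //.
  apply: improves_sub imp => u' [h1 h2 h3]; split=> // i; lia.
Qed.

(** [pw_edge] makes the visited set closed under adjacency, so a walk that is maximal among new
    vertices has no edge to an old one. *)
Record partial_walks (t : nat) (s : store) (ws : seq (seq 'I_n)) : Prop := PartialWalks {
  pw_uniq : uniq ws;
  pw_uniq_walk w : w \in ws -> uniq w;
  pw_sorted w : w \in ws -> sorted G w;
  pw_disjoint w w' v : w \in ws -> w' \in ws -> v \in w -> v \in w' -> w = w';
  pw_visited (v : 'I_n) : (s VIS v != 0) = has (fun w => v \in w) ws;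
  pw_prefix (v : 'I_n) : v < t -> has (fun w => v \in w) ws;
  pw_edge w u v : w \in ws -> u \in w -> G u v -> walk_edge n G w u v /\ v \in w }.

Lemma partial_walks_cons t s s' ws w (v0 : 'I_n) : v0 = t :> nat ->
  partial_walks t s ws -> w != [::] -> v0 \in w ->
  tracing n G (fun v => has (fun w => v \in w) ws) s' w ->
  (forall u v, u \in w -> G u v -> walk_edge n G w u v /\ v \in w) ->
  partial_walks t.+1 s' (w :: ws).
Proof.
move=> v0t [h1 h2 h3 h4 h5 h6 h7] wn v0w [t1 t2 t3 t4 t5] we.
have wnew v w' : v \in w -> w' \in ws -> v \in w' -> False.
  by move=> /t3 /hasPn nv /nv /negP.
split.
- rewrite cons_uniq h1 andbT; apply/negP => ww; exact: (wnew v0 w).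
- by move=> w'; rewrite inE => /orP[/eqP ->|/h2].
- by move=> w'; rewrite inE => /orP[/eqP ->|/h3].
- move=> w1 w2 v; rewrite !inE => /orP[/eqP ->|i1] /orP[/eqP ->|i2] // g1 g2.
  + by case: (wnew v w2).
  + by case: (wnew v w1).
  + exact: h4 g1 g2.
- by move=> v; rewrite t4 /= orbC.
- move=> v; rewrite ltnS leq_eqVlt => /orP[/eqP vt|/h6 /= ->]; last by rewrite orbT.
  by rewrite /= (_ : v = v0) ?v0w //; apply: val_inj; rewrite /= v0t.
- by move=> w' u v; rewrite inE => /orP[/eqP ->|]; [apply: we|apply: h7].
Qed.

Lemma main_programP : exists ws (k : seq 'I_n -> nat),
  [/\ walk_decomposition n G ws, forall w, w \in ws -> exact_cost w (k w) &
      run (main_program c) (fun _ _ => 0) TOT 0 = \sum_(w <- ws) k w].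
Proof.
case: (simpleG) => _ symG; rewrite /main_program sem_seq.
set s1 := run init_rows _.
have rows1 : rows_ok n s1 by apply: init_rowsP.
have e1 a : a \notin [:: IDX; POSX; ROW] -> s1 a = fun=> 0.
  by move=> h; rewrite /s1 (sem_frame_sub _ [:: IDX; POSX; ROW]).
have := loop_rule inp (fun t s => exists ws (k : seq 'I_n -> nat),
  [/\ partial_walks t s ws, forall w, w \in ws -> exact_cost w (k w) &
      s TOT 0 = \sum_(w <- ws) k w]) 1 0 START 0 (If (Rd VIS (Var START)) Skip (process c)) s1.
rewrite bound1; case.
- exists [::], (fun=> 0); split=> //; last by rewrite big_nil e1.
  by split=> // v; rewrite e1.
- move=> t s tn fr [ws [k [pw ek tot]]]; pose v0 := Ordinal tn.
  set s2 := set_cell s START 0 t.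
  have pw2 : partial_walks t s2 ws.
    by case: pw => *; split=> // *; rewrite /s2 ?set_cell_other.
  have V2 : s2 START 0 = v0 by rewrite /s2 get_set.
  rewrite sem_if [eval _ _ _]/= V2 (pw_visited _ _ _ pw2 v0); case: ifP => hv.
    rewrite sem_skip; exists ws, k; split=> //.
    case: pw2 => h1 h2 h3 h4 h5 h6 h7; split=> // v.
    rewrite ltnS leq_eqVlt => /orP[/eqP vt|/h6 //].
    by rewrite (_ : v = v0) //; apply: val_inj.
  have rows2 : rows_ok n s2.
    move=> z; rewrite /s2 set_cell_other // fr ?rows1 //.
    have h : ROW \notin mods (search c c.-1) by apply: notin_sub (mods_search c c.-1) _.
    rewrite -[mods _]/(mods trace_walk ++ (mods tabulate ++
      ([:: BEST] ++ (mods (search c c.-1) ++ [:: TOT])))).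
    by rewrite inE !mem_cat (negbTE h).
  have := processP (fun v => has (fun w => v \in w) ws) s2 v0 rows2 V2
    (pw_visited _ _ _ pw2) (negbT hv).
  move=> [u [p [b [tr v0w [st1 st2] tot2 ec]]]]; set w := u :: p in tr v0w st1 st2 ec.
  have we x y : x \in w -> G x y -> walk_edge n G w x y /\ y \in w.
    case: tr => t1 t2 t3 t4 t5.
    apply: (stuck_walk_edge n G (fun v => has (fun w => v \in w) ws) u p) => //.
    move=> v v' /hasP[w' ww' vw'] g; apply/hasP; exists w' => //.
    by case: (pw_edge _ _ _ pw2 w' v v').
  have wnew : w \notin ws.
    apply/negP => ww; have := tr_new _ _ _ _ _ tr v0 v0w.
    by move/hasPn => /(_ w ww); rewrite v0w.
  exists (w :: ws), (fun w' => if w' == w then b else k w'); split.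
  + exact: partial_walks_cons pw2 _ v0w tr we.
  + by move=> w'; rewrite inE; case: eqP => [-> //|_ /=]; apply: ek.
  + rewrite big_cons eqxx tot2 /s2 set_cell_other // tot addnC; congr (_ + _).
    apply: eq_big_seq => w' ww'; rewrite ifN //.
    by apply: contraNneq wnew => <-.
- move=> ws [k [pw ek tot]]; exists ws, k; split=> //.
  case: pw => h1 h2 h3 h4 h5 h6 h7; split=> //.
  + by move=> v; apply/hasP; apply: h6.
  + move=> u v g; have /hasP[w ww uw] := h6 u (ltn_ord u).
    by exists w => //; case: (h7 w u v).
Qed.

(** The halves of [exact_cost] serve the two directions: a total within 2l has all its terms within
    2l, hence feasible; a swapping sequence gives order-feasible costs, which dominate the terms. *)
Lemma main_program_correct : token_placement c f0 ->
  eval inp (run (main_program c) (fun _ _ => 0)) answer = 1 <-> OPT_le c G f0 ft l.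
Proof.
move=> tf; have [ws [k [wd ek tot]]] := main_programP.
have -> : eval inp (run (main_program c) (fun _ _ => 0)) answer =
    1 - (\sum_(w <- ws) k w - l.*2) by rewrite /= tot addnn.
split.
- move=> h; have le : \sum_(w <- ws) k w <= l.*2 by lia.
  apply: (feasible_OPT_le _ _ c ws f0 ft k l wd tf _ le) => w ww.
  have [h1 _] := ek w ww; apply: h1; apply: leq_trans le.
  by rewrite (big_rem w) //= leq_addr.
- move=> [s [ps ls _ sl]].
  have [k' hk' sk'] := swap_sequence_order_feasible _ _ ws f0 ft s wd ps ls.
  have : \sum_(w <- ws) k w <= \sum_(w <- ws) k' w.
    rewrite !big_seq; apply: leq_sum => w ww.
    by have [_ h] := ek w ww; apply: h; apply: hk'.
  by move=> le; have := leq_trans le sk'; rewrite -leq_double in sl; lia.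
Qed.

End Main.

Theorem mainTheorem4 :
  forall c : nat,
  exists (P : program) (K : nat),
    forall (n : nat) (G : rel 'I_n) (f0 ft : placement n) (l : nat),
      simple_graph G -> max_degree_le G 2 ->
      token_placement c f0 -> token_placement c ft ->
      exists out : nat,
        runs_within P (encode_instance G f0 ft l) (K * n.+1 ^ (c + 2)) out /\
        (out = 1 <-> OPT_le c G f0 ft l).
Proof.
case=> [|c].
  (* Without colours there can be no vertex, so the two placements coincide and the constant answer
     1 is right. *)
  have [P [K HP]] := compile_correct Skip (Cst 1) isT isT.
  exists P, K => n G f0 ft l _ _ tf _; have /andP[/forallP h0 _] := tf.
  have n0 : n = 0 by case: n {G ft tf} f0 h0 => // n f0 /(_ ord0); lia.
  exists 1; split.
    have E k : n.+1 ^ k = 1 by rewrite n0 exp1n.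
    by have := HP (encode_instance G f0 ft l); rewrite inp_n !E.
  split=> // _; exists [::]; split=> //=; last by rewrite tf.
  by apply/ffunP => v; have := ltn_ord v; rewrite [X in _ < X]n0.
have wf := main_wf c.+1.
have [P [K HP]] := compile_correct _ answer wf isT.
exists P, K => n G f0 ft l sg dg tf tft.
set inp := encode_instance G f0 ft l.
exists (eval inp (sem inp (main_program c.+1) (fun _ _ => 0)) answer).
split.
  by have := HP inp; rewrite depth_main // addn2.
apply: main_program_correct => // v.
by have /andP[/forallP] := tf.
Qed.
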